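(* Let $f:\mathbb{R}^n\to\mathbb{R}$ be differentiable with $L_f$-Lipschitz continuous gradient, let $g:\mathbb{R}^n\to\mathbb{R}\cup\{+\infty\}$ be proper, lower semicontinuous, $\gamma_g$-prox-bounded and $\rho$-weakly convex, let $\varphi=f+g$ with $\operatorname{argmin}\varphi\neq\emptyset$. Consider the iterates generated by the PGCL algorithm described in the context, and suppose $(\bar x^k)$ converges to a strong local minimizer $x^\star$ of $\varphi$ such that $f$ is of class $C^3$ locally around $x^\star$ and $\operatorname{prox}_{\gamma g}$ is of class $C^1$ locally around $x^\star-\gamma\nabla f(x^\star)$. If for all $k$ sufficiently large $d^k=d_N^k:=-B_k^{-1}\nabla\varphi_\gamma(\bar x^k)$, then eventually $\tau_k=1$ is always accepted, and the sequences $(x^k)$, $(\bar x^k)$, $(r^k)$ converge superlinearly (to $x^\star$, $x^\star$, $0$ respectively).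
   Context: Strong local minimizer: there exist $c,\epsilon>0$ with $\varphi(x)\ge\varphi(x^\star)+c\|x-x^\star\|^2$ whenever $\|x-x^\star\|<\epsilon$. $\gamma_g$-prox-bounded: $g+\frac1{2\gamma}\|\cdot\|^2$ bounded below for each $\gamma\in(0,\gamma_g)$; $\rho$-weakly convex: $g+\frac\rho2\|\cdot\|^2$ convex. $\operatorname{prox}_{\gamma g}(x)=\operatorname{argmin}_z\{g(z)+\frac1{2\gamma}\|z-x\|^2\}$, $T_\gamma(x)=\operatorname{prox}_{\gamma g}(x-\gamma\nabla f(x))$, $R_\gamma(x)=\gamma^{-1}(x-T_\gamma(x))$. Forward-backward envelope $\varphi_\gamma(x)=\inf_u\{f(x)+\langle\nabla f(x),u-x\rangle+g(u)+\frac1{2\gamma}\|u-x\|^2\}$. $\partial_C$: Clarke generalized Jacobian. PGCL: given $x^0$, $\gamma\in(0,\min\{1/L_f,\gamma_g\})$, $\sigma\in(0,\gamma\frac{1-\gamma L_f}{2})$, $\beta\in(0,1)$, $\mu\in(0,1)$; for $k=0,1,\dots$: select $\bar x^k\in T_\gamma(x^k)$, $r^k=\gamma^{-1}(x^k-\bar x^k)$; select $\bar r^k\in R_\gamma(\bar x^k)$, $Q_k\in I-\gamma\partial_C(\nabla f)(\bar x^k)$, $P_k\in\partial_C\operatorname{prox}_{\gamma g}(\bar x^k-\gamma\nabla f(\bar x^k))$; $B_k=\gamma^{-1}Q_k(I-P_kQ_k)$; stop if $\bar r^k=0$ and $\lambda_{\min}(B_k)\ge0$; select $d^k,s^k$ with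 $\langle Q_k\bar r^k,d^k\rangle\le0$, $\langle Q_k\bar r^k,s^k\rangle\le0$, and $\langle B_ks^k,s^k\rangle<0$ if $\lambda_{\min}(B_k)<0$, $=0$ otherwise; let $\tau_k$ be the largest element of $\{\beta^m:m\in\mathbb N\}$ such that $x^{k+1}=\bar x^k+\tau_k^2d^k+\tau_ks^k$ satisfies $\varphi_\gamma(x^{k+1})\le\varphi_\gamma(x^k)-\sigma\|r^k\|^2+\frac\mu2\tau_k^2\langle B_ks^k,s^k\rangle$. *)

(* Defs.v *)
From HB Require Import structures.
From mathcomp Require Import all_boot all_order all_algebra.
From mathcomp Require Import all_classical all_reals ereal.
Set Implicit Arguments. Unset Strict Implicit. Unset Printing Implicit Defensive.
Import Order.TTheory GRing.Theory Num.Theory.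
Local Open Scope ring_scope.
Local Open Scope classical_set_scope.

Section Defs.
Variable R : realType.

Definition enorm (p q : nat) (M : 'M[R]_(p, q)) : R :=
  Num.sqrt (\sum_(i < p) \sum_(j < q) M i j ^+ 2).
Definition dot (n : nat) (u v : 'cV[R]_n) : R := \sum_(i < n) u i 0 * v i 0.

Definition cvg_seq (p q : nat) (u : nat -> 'M[R]_(p, q)) (l : 'M[R]_(p, q)) :=
  forall eps : R, 0 < eps -> exists N : nat, forall k, (N <= k)%N ->
    enorm (u k - l) < eps.
Definition superlinear (n : nat) (u : nat -> 'cV[R]_n) (l : 'cV[R]_n) :=
  cvg_seq u l /\
  forall eps : R, 0 < eps -> exists N : nat, forall k, (N <= k)%N ->
    enorm (u k.+1 - l) <= eps * enorm (u k - l).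

Definition has_jac (n m : nat) (F : 'cV[R]_n -> 'cV[R]_m) (x : 'cV[R]_n)
  (J : 'M[R]_(m, n)) :=
  forall eps : R, 0 < eps -> exists delta : R, 0 < delta /\
    forall y, enorm (y - x) < delta ->
      enorm (F y - F x - J *m (y - x)) <= eps * enorm (y - x).
Definition has_grad (n : nat) (f : 'cV[R]_n -> R) (x v : 'cV[R]_n) :=
  forall eps : R, 0 < eps -> exists delta : R, 0 < delta /\
    forall y, enorm (y - x) < delta ->
      `|f y - f x - dot v (y - x)| <= eps * enorm (y - x).
Definition has_gradE (n : nat) (F : 'cV[R]_n -> \bar R) (x v : 'cV[R]_n) :=
  (exists delta : R, 0 < delta /\
     forall y, enorm (y - x) < delta -> F y \is a fin_num) /\
  has_grad (fun y => fine (F y)) x v.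

Definition cont_at (n p q : nat) (F : 'cV[R]_n -> 'M[R]_(p, q)) x :=
  forall eps : R, 0 < eps -> exists delta : R, 0 < delta /\
    forall y, enorm (y - x) < delta -> enorm (F y - F x) < eps.

Definition ball_e (n : nat) (c : 'cV[R]_n) (r : R) : set 'cV[R]_n :=
  [set y | enorm (y - c) < r].

Definition C1_on (n m : nat) (F : 'cV[R]_n -> 'cV[R]_m) (U : set 'cV[R]_n) :=
  exists J : 'cV[R]_n -> 'M[R]_(m, n),
    (forall y, U y -> has_jac F y (J y)) /\ (forall y, U y -> cont_at J y).
Definition C2_on (n m : nat) (F : 'cV[R]_n -> 'cV[R]_m) (U : set 'cV[R]_n) :=
  exists J : 'cV[R]_n -> 'M[R]_(m, n),
    (forall y, U y -> has_jac F y (J y)) /\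
    C1_on (fun y => (mxvec (J y))^T) U.

Definition C3_near (n : nat) (f : 'cV[R]_n -> R) (x : 'cV[R]_n) :=
  exists (r : R) (G : 'cV[R]_n -> 'cV[R]_n), 0 < r /\
    (forall y, ball_e x r y -> has_grad f y (G y)) /\ C2_on G (ball_e x r).

Definition C1_near_sv (n : nat) (S : 'cV[R]_n -> set 'cV[R]_n) (x : 'cV[R]_n) :=
  exists (r : R) (s : 'cV[R]_n -> 'cV[R]_n), 0 < r /\
    (forall y, ball_e x r y -> S y = [set s y]) /\ C1_on s (ball_e x r).

Definition diff_pt (n : nat) (S : 'cV[R]_n -> set 'cV[R]_n) x (J : 'M[R]_n) :=
  exists (r : R) (s : 'cV[R]_n -> 'cV[R]_n), 0 < r /\
    (forall y, ball_e x r y -> S y = [set s y]) /\ has_jac s x J.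
Definition bjac (n : nat) (S : 'cV[R]_n -> set 'cV[R]_n) x (M : 'M[R]_n) :=
  exists (xs : nat -> 'cV[R]_n) (Js : nat -> 'M[R]_n),
    cvg_seq xs x /\ (forall k, diff_pt S (xs k) (Js k)) /\ cvg_seq Js M.
Definition clarke (n : nat) (S : 'cV[R]_n -> set 'cV[R]_n) x (M : 'M[R]_n) :=
  exists (m : nat) (lam : 'I_m -> R) (Ms : 'I_m -> 'M[R]_n),
    (forall i, 0 <= lam i) /\ \sum_(i < m) lam i = 1 /\
    (forall i, bjac S x (Ms i)) /\ M = \sum_(i < m) lam i *: Ms i.

Definition proper_fun (n : nat) (g : 'cV[R]_n -> \bar R) :=
  (exists x, (g x < +oo)%E) /\ (forall x, (-oo < g x)%E).
Definition lsc (n : nat) (g : 'cV[R]_n -> \bar R) :=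
  forall x (a : R), (a%:E < g x)%E -> exists delta : R, 0 < delta /\
    forall y, enorm (y - x) < delta -> (a%:E < g y)%E.
Definition prox_bounded (n : nat) (g : 'cV[R]_n -> \bar R) (gg : \bar R) :=
  forall gam : R, 0 < gam -> (gam%:E < gg)%E ->
    exists b : R, forall x, (b%:E <= g x + ((2 * gam)^-1 * enorm x ^+ 2)%:E)%E.
Definition convex_ext (n : nat) (h : 'cV[R]_n -> \bar R) :=
  forall (x y : 'cV[R]_n) (t : R), 0 < t -> t < 1 ->
    (h (t *: x + (1 - t) *: y)%R <= (t%:E * h x + (1 - t)%:E * h y)%E)%E.
Definition weakly_convex (n : nat) (g : 'cV[R]_n -> \bar R) (rho : R) :=
  convex_ext (fun x => g x + (rho / 2 * enorm x ^+ 2)%:E)%E.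

Definition prox (n : nat) (gam : R) (g : 'cV[R]_n -> \bar R) (x : 'cV[R]_n)
  : set 'cV[R]_n :=
  [set z | forall w,
     (g z + ((2 * gam)^-1 * enorm (z - x) ^+ 2)%:E <=
      g w + ((2 * gam)^-1 * enorm (w - x) ^+ 2)%:E)%E].
Definition Tgam (n : nat) gam g (gf : 'cV[R]_n -> 'cV[R]_n) x :=
  prox gam g (x - gam *: gf x).
Definition Rgam (n : nat) gam g (gf : 'cV[R]_n -> 'cV[R]_n) x : set 'cV[R]_n :=
  [set gam^-1 *: (x - z) | z in Tgam gam g gf x].
Definition fbe (n : nat) gam (f : 'cV[R]_n -> R) (gf : 'cV[R]_n -> 'cV[R]_n)
  (g : 'cV[R]_n -> \bar R) (x : 'cV[R]_n) : \bar R :=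
  ereal_inf (range (fun u =>
    ((f x + dot (gf x) (u - x) + (2 * gam)^-1 * enorm (u - x) ^+ 2)%:E + g u)%E)).

Definition lmin_ge0 (n : nat) (B : 'M[R]_n) := forall a, eigenvalue B a -> 0 <= a.
Definition lmin_lt0 (n : nat) (B : 'M[R]_n) := exists a, eigenvalue B a /\ a < 0.

Definition pgcl_iterates (n : nat) (f : 'cV[R]_n -> R) (gf : 'cV[R]_n -> 'cV[R]_n)
  (g : 'cV[R]_n -> \bar R) (gam sigma beta mu : R)
  (x xb r rb : nat -> 'cV[R]_n) (Q P B : nat -> 'M[R]_n)
  (d s : nat -> 'cV[R]_n) (tau : nat -> R) :=
  forall k : nat,
    Tgam gam g gf (x k) (xb k) /\
    r k = gam^-1 *: (x k - xb k) /\
    Rgam gam g gf (xb k) (rb k) /\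
    (exists H, clarke (fun y => [set gf y]) (xb k) H /\ Q k = 1%:M - gam *: H) /\
    clarke (prox gam g) (xb k - gam *: gf (xb k)) (P k) /\
    B k = gam^-1 *: (Q k *m (1%:M - P k *m Q k)) /\
    (* the stopping criterion is never met *)
    ~ (rb k = 0 /\ lmin_ge0 (B k)) /\
    dot (Q k *m rb k) (d k) <= 0 /\
    dot (Q k *m rb k) (s k) <= 0 /\
    (lmin_lt0 (B k) -> dot (B k *m s k) (s k) < 0) /\
    (~ lmin_lt0 (B k) -> dot (B k *m s k) (s k) = 0) /\
    (let accept t :=
       (fbe gam f gf g (xb k + (t ^+ 2) *: d k + t *: s k) <=
        fbe gam f gf g (x k)
        + (- (sigma * enorm (r k) ^+ 2)
           + mu / 2 * t ^+ 2 * dot (B k *m s k) (s k))%:E)%E in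
     exists m : nat, tau k = beta ^+ m /\ accept (beta ^+ m) /\
       (forall m' : nat, (m' < m)%N -> ~ accept (beta ^+ m'))) /\
    x k.+1 = xb k + (tau k ^+ 2) *: d k + tau k *: s k.

End Defs.

(* Main.v *)
(** Strong local minimality of [f + g] passes to the forward-backward envelope,
    whose second-order expansion at [xstar] is governed by
    [B = gam^-1 Q (I - P Q)]; hence [B] is positive definite there, although it
    need not be symmetric.  Near [xstar] the gradient of the envelope is
    [Q^T R], with Jacobian [B] at [xstar] (the Hessian of [f] is symmetric), and
    the elements chosen by the algorithm are the Jacobians themselves, so the
    Newton step is a superlinear contraction of the error of [xb].  Positive
    definiteness forces [s k = 0], and the envelope at the Newton point exceeds
    the minimum by [o(|xb - xstar|^2)], while the right-hand side of the
    acceptance test exceeds it by a multiple of [|xb - xstar|^2]: the unit step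
    passes.  [xstar] is a fixed point of [T_gamma] because the steps [r k] tend
    to [0] and the graph of the proximal map is closed. *)
Require Import Defs.
From HB Require Import structures.
From mathcomp Require Import all_boot all_order all_algebra.
From mathcomp Require Import all_classical all_reals ereal.
From mathcomp Require Import ring lra.
Set Implicit Arguments. Unset Strict Implicit. Unset Printing Implicit Defensive.
Import Order.TTheory GRing.Theory Num.Theory.
Local Open Scope ring_scope.
Local Open Scope classical_set_scope.

(** Two steps of the overview rest on one margin, [(1 - gam * L) / (2 * gam)], by which the proximal
    model at [x] lies above [f]. At the point [T y] it carries the growth of [f + g] back to growth
    of the envelope at [y]. At [xb k] it pays for [sigma * enorm (r k) ^+ 2], so the right-hand side
    of the acceptance test stays above the value of [f + g] at [xb k], where strong minimality
    applies. The obstacle is that neither a Hessian of the envelope nor symmetry of the Jacobian of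
    the proximal map is established: upper second-order expansions alone are set against the lower
    bound coming from growth, and the quadratic form of [B] stands in for its spectrum and its
    inverse. Gradients are not obtained by differentiating an infimum, but by comparing minimizers
    or from a touching majorant. *)

Section Euclidean.
Variable R : realType.
Implicit Types (n m p q : nat).

(** * Inner product, Frobenius norm and a mean value inequality *)

Lemma dotC n (u v : 'cV[R]_n) : dot u v = dot v u.
Proof. by apply: eq_bigr => i _; rewrite mulrC. Qed.

Lemma dotDl n (u v w : 'cV[R]_n) : dot (u + v) w = dot u w + dot v w.
Proof. by rewrite -big_split; apply: eq_bigr => i _; rewrite !mxE mulrDl. Qed.

Lemma dotZl n a (u v : 'cV[R]_n) : dot (a *: u) v = a * dot u v.
Proof. by rewrite mulr_sumr; apply: eq_bigr => i _; rewrite !mxE mulrA. Qed.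

Lemma dotNl n (u v : 'cV[R]_n) : dot (- u) v = - dot u v.
Proof. by rewrite -scaleN1r dotZl mulN1r. Qed.

Lemma dotDr n (u v w : 'cV[R]_n) : dot u (v + w) = dot u v + dot u w.
Proof. by rewrite dotC dotDl !(dotC u). Qed.

Lemma dotZr n a (u v : 'cV[R]_n) : dot u (a *: v) = a * dot u v.
Proof. by rewrite dotC dotZl dotC. Qed.

Lemma dotNr n (u v : 'cV[R]_n) : dot u (- v) = - dot u v.
Proof. by rewrite dotC dotNl dotC. Qed.

Lemma dot0l n (v : 'cV[R]_n) : dot 0 v = 0.
Proof. by rewrite -(scale0r 0) dotZl mul0r. Qed.

Definition dotE := (dotDl, dotDr, dotNl, dotNr, dotZl, dotZr).

Lemma dot_mulmxl n m (A : 'M[R]_(m, n)) (u : 'cV[R]_n) (v : 'cV[R]_m) :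
  dot (A *m u) v = dot u (A^T *m v).
Proof.
rewrite /dot; under eq_bigr => i _ do rewrite mxE mulr_suml.
rewrite exchange_big; apply: eq_bigr => j _ /=.
rewrite mxE mulr_sumr; apply: eq_bigr => i _; rewrite mxE; ring.
Qed.

Lemma sumsq_ge0 p q (M : 'M[R]_(p, q)) :
  0 <= \sum_(i < p) \sum_(j < q) M i j ^+ 2.
Proof. by apply: sumr_ge0 => i _; apply: sumr_ge0 => j _; apply: sqr_ge0. Qed.

Lemma enorm_ge0 p q (M : 'M[R]_(p, q)) : 0 <= enorm M.
Proof. exact: sqrtr_ge0. Qed.

Lemma enorm_sqr p q (M : 'M[R]_(p, q)) :
  enorm M ^+ 2 = \sum_(i < p) \sum_(j < q) M i j ^+ 2.
Proof. by rewrite sqr_sqrtr // sumsq_ge0. Qed.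

Lemma enorm_dot n (u : 'cV[R]_n) : enorm u ^+ 2 = dot u u.
Proof.
by rewrite enorm_sqr; apply: eq_bigr => i _; rewrite big_ord1 expr2.
Qed.

Lemma enorm_mxvec p q (M : 'M[R]_(p, q)) : enorm (mxvec M)^T = enorm M.
Proof.
rewrite /enorm; congr Num.sqrt.
under eq_bigr => i _ do rewrite big_ord1 mxE.
rewrite pair_big /= (reindex _ (curry_mxvec_bij _ _)) /=.
by apply: eq_bigr => -[i j] _ /=; rewrite mxvecE.
Qed.

(** The form [H] in [(x, y)] is a sum of squares, and at [(C, A)] it factors as
    [A * (A * B - C ^+ 2)]. If [A = 0], a nonzero [C] would make it negative at
    [((B + 1) / C, 1)]. *)
Lemma cauchy_sums (I : finType) (a b : I -> R) :
  (\sum_i a i * b i) ^+ 2 <= (\sum_i a i ^+ 2) * (\sum_i b i ^+ 2).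
Proof.
set A := \sum_i a i ^+ 2; set B := \sum_i b i ^+ 2; set C := \sum_i _.
have A0 : 0 <= A by apply: sumr_ge0 => i _; apply: sqr_ge0.
have H x y : 0 <= x ^+ 2 * A - 2 * x * y * C + y ^+ 2 * B.
  have -> : x ^+ 2 * A - 2 * x * y * C + y ^+ 2 * B
            = \sum_i (x * a i - y * b i) ^+ 2.
    rewrite !mulr_sumr -sumrB -big_split /=.
    by apply: eq_bigr => i _; ring.
  by apply: sumr_ge0 => i _; apply: sqr_ge0.
have [A_gt0|] := ltP 0 A.
  have := H C A; nra.
move=> Ale0; have {Ale0 A0} A0 : A = 0 by lra.
have [->|C0] := eqVneq C 0; first by rewrite A0 expr0n mul0r.
have := H ((B + 1) / C) 1; have := H 0 1; rewrite A0.
have -> : 2 * ((B + 1) / C) * 1 * C = 2 * (B + 1) by field.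
lra.
Qed.

Lemma dot_sqr_le n (u v : 'cV[R]_n) : dot u v ^+ 2 <= (enorm u * enorm v) ^+ 2.
Proof.
rewrite exprMn !enorm_dot /dot; apply: le_trans (cauchy_sums _ _) _.
by rewrite lexx.
Qed.

Lemma ler_of_sqr (a b : R) : 0 <= b -> a ^+ 2 <= b ^+ 2 -> a <= b.
Proof. by move=> b0 ab; nra. Qed.

Lemma dot_le n (u v : 'cV[R]_n) : dot u v <= enorm u * enorm v.
Proof. by apply: ler_of_sqr (dot_sqr_le _ _); rewrite mulr_ge0 ?enorm_ge0. Qed.

Lemma enormZ p q a (M : 'M[R]_(p, q)) : enorm (a *: M) = `|a| * enorm M.
Proof.
rewrite /enorm -sqrtr_sqr -sqrtrM ?sqr_ge0 // mulr_sumr; congr Num.sqrt.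
apply: eq_bigr => i _; rewrite mulr_sumr; apply: eq_bigr => j _.
by rewrite mxE exprMn.
Qed.

Lemma enormN p q (M : 'M[R]_(p, q)) : enorm (- M) = enorm M.
Proof. by rewrite -scaleN1r enormZ normrN normr1 mul1r. Qed.

Lemma dot_norm_le n (u v : 'cV[R]_n) : `|dot u v| <= enorm u * enorm v.
Proof. by rewrite ler_norml dot_le andbT lerNl -dotNl -(enormN u) dot_le. Qed.

Lemma enorm_distC p q (M N : 'M[R]_(p, q)) : enorm (M - N) = enorm (N - M).
Proof. by rewrite -opprB enormN. Qed.

Lemma enorm0 p q : enorm (0 : 'M[R]_(p, q)) = 0.
Proof. by rewrite -(scale0r 0) enormZ normr0 mul0r. Qed.

Lemma ler_enormD p q (M N : 'M[R]_(p, q)) : enorm (M + N) <= enorm M + enorm N.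
Proof.
rewrite -[enorm (M + N)]enorm_mxvec -[enorm M]enorm_mxvec -[enorm N]enorm_mxvec.
rewrite !linearD /=; set u := (mxvec M)^T; set v := (mxvec N)^T.
have u0 := enorm_ge0 u; have v0 := enorm_ge0 v.
apply: ler_of_sqr; first by lra.
rewrite enorm_dot !dotE (dotC v u) -!enorm_dot.
by have := dot_le u v; nra.
Qed.

Lemma ler_enormB p q (M N : 'M[R]_(p, q)) : enorm (M - N) <= enorm M + enorm N.
Proof. by rewrite -(enormN N) ler_enormD. Qed.

Lemma ler_enorm_dist p q (M N K : 'M[R]_(p, q)) :
  enorm (M - N) <= enorm (M - K) + enorm (K - N).
Proof. by apply: le_trans (ler_enormD _ _); rewrite subrKA. Qed.

Lemma enorm_eq0 p q (M : 'M[R]_(p, q)) : enorm M <= 0 -> M = 0.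
Proof.
move=> M0; have {}M0 : enorm M ^+ 2 = 0.
  by have := enorm_ge0 M => M1; have -> : enorm M = 0; [lra | rewrite expr0n].
move: M0; rewrite enorm_sqr => /eqP; rewrite psumr_eq0; last first.
  by move=> i _; apply: sumr_ge0 => j _; apply: sqr_ge0.
move=> /allP M0; apply/matrixP => i j; rewrite mxE.
have := M0 i (mem_index_enum _); rewrite /= psumr_eq0; last first.
  by move=> k _; apply: sqr_ge0.
by move=> /allP /(_ j (mem_index_enum _)); rewrite /= sqrf_eq0 => /eqP.
Qed.

Lemma enorm_mulmx p q m (M : 'M[R]_(p, q)) (N : 'M[R]_(q, m)) :
  enorm (M *m N) <= enorm M * enorm N.
Proof.
apply: ler_of_sqr; first by rewrite mulr_ge0 ?enorm_ge0.
rewrite exprMn !enorm_sqr mulr_suml; apply: ler_sum => i _.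
rewrite [X in _ * X]exchange_big mulr_sumr; apply: ler_sum => k _ /=.
by rewrite mxE cauchy_sums.
Qed.

Lemma enorm_tr p q (M : 'M[R]_(p, q)) : enorm M^T = enorm M.
Proof.
rewrite /enorm exchange_big; congr Num.sqrt.
by apply: eq_bigr => i _; apply: eq_bigr => j _; rewrite mxE.
Qed.

Lemma mx_eq0_enorm m n (A : 'M[R]_(m, n)) :
  (forall u : 'cV[R]_n, A *m u = 0) -> A = 0.
Proof.
move=> A0; apply/matrixP => i j.
by have /matrixP/(_ i 0) := A0 (delta_mx j 0); rewrite -colE !mxE.
Qed.

Lemma ler_of_eps (a b : R) : (forall e, 0 < e -> a <= b + e) -> a <= b.
Proof. by move=> H; apply/ler_addgt0Pr. Qed.

(* At the supremum [c] of the times up to which the bound holds, the estimate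
   at [c] first gives the bound at [c], then pushes it past [c]. *)
Lemma mean_value_le0 (phi D : R -> R) :
  (forall t, 0 <= t <= 1 -> forall e, 0 < e -> exists del, 0 < del /\
     forall t', 0 <= t' <= 1 -> `|t' - t| < del ->
     `|phi t' - phi t - D t * (t' - t)| <= e * `|t' - t|) ->
  (forall t, 0 <= t <= 1 -> D t <= 0) -> phi 1 <= phi 0.
Proof.
move=> dphi D0; apply: ler_of_eps => e e0.
pose S : set R := [set t | 0 <= t <= 1 /\ phi t <= phi 0 + e * t].
have S0 : S 0 by split; [lra | rewrite mulr0 addr0].
have supS : has_sup S.
  by split; [exists 0 | exists 1 => t [/andP[]]].
set c := sup S.
have c0 : 0 <= c by apply: ub_le_sup => //; case: supS.
have c1 : c <= 1 by apply: ge_sup; [exists 0 | move=> t [/andP[]]].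
have c01 : 0 <= c <= 1 by rewrite c0.
have [del [del0 hdel]] := dphi c c01 e e0.
have Dc := D0 c c01.
have Sc : phi c <= phi 0 + e * c.
  have [t [/andP[t0 t1] St] tc] := sup_adherent del0 supS.
  have tc' : t <= c by apply: ub_le_sup; [case: supS | split; rewrite ?t0].
  rewrite -/c in tc.
  have := hdel t; rewrite t0 t1 [`|t - c|]ler0_norm ?subr_le0 // ler_norml.
  by move=> /(_ isT); case/(_ _)/andP => [|h1 h2]; nra.
have [->|cn1] := eqVneq 1 c; first by nra.
have clt1 : c < 1 by rewrite lt_neqAle eq_sym cn1.
pose t := Num.min 1 (c + del / 2).
have ct : c < t by rewrite lt_min clt1 /=; lra.
have t1 : t <= 1 by rewrite ge_min lexx.
have td : t <= c + del / 2 by rewrite ge_min lexx orbT.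
suff : S t.
  move=> /(ub_le_sup supS.2); rewrite -/c; lra.
split; first by lra.
have tc : 0 <= t - c by lra.
have := hdel t; rewrite t1 (ger0_norm tc) ler_norml.
by case/(_ _ _)/andP => [||h1 h2]; nra.
Qed.

(** Subtracting the primitive [a * t + b / 2 * t ^+ 2] of the slope bound leaves a function with
    nonpositive derivative. The Taylor-type bounds below are all instances of this. *)
Lemma mean_value_quad n (f : 'cV[R]_n -> R) (gf : 'cV[R]_n -> 'cV[R]_n)
  (x v : 'cV[R]_n) (a b : R) :
  (forall t, 0 <= t <= 1 -> has_grad f (x + t *: v) (gf (x + t *: v))) ->
  (forall t, 0 <= t <= 1 -> dot (gf (x + t *: v)) v <= a + b * t) ->
  f (x + v) - f x <= a + b / 2.
Proof.
move=> fg slope.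
pose phi t := f (x + t *: v) - a * t - b / 2 * t ^+ 2.
pose D t := dot (gf (x + t *: v)) v - a - b * t.
suff : phi 1 <= phi 0 by rewrite /phi scale1r scale0r addr0; lra.
apply: (@mean_value_le0 phi D); last by move=> t /slope; rewrite /D; lra.
move=> t t01 e e0; pose N := enorm v.
have N0 : 0 <= N := enorm_ge0 v.
have e1 : 0 < e / (2 * (N + 1)) by apply: divr_gt0; lra.
have [d1 [d10 hd1]] := fg t t01 _ e1.
(* The first radius keeps the point within [d1]; the second makes the quadratic term
   [b / 2 * (t' - t) ^+ 2] cost at most half of [e]. *)
exists (Num.min (d1 / (N + 1)) (e / (`|b| + 1))); split.
  have := normr_ge0 b => b0.
  by rewrite lt_min !divr_gt0 //; lra.
move=> t' t'01; rewrite lt_min => /andP[tt1 tt2].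
have Et : x + t' *: v - (x + t *: v) = (t' - t) *: v.
  by rewrite scalerBl opprD addrACA subrr add0r.
have := hd1 (x + t' *: v); rewrite Et enormZ dotZr -/N.
set k := `|t' - t| in tt1 tt2 *.
have k0 : 0 <= k := normr_ge0 _.
have tt1' : k * (N + 1) < d1 by rewrite -ltr_pdivlMr //; lra.
set q := _ - _ - _ => hq.
have {}hq : `|q| <= e / (2 * (N + 1)) * (k * N) by apply: hq; nra.
have -> : phi t' - phi t - D t * (t' - t) = q - b / 2 * (t' - t) ^+ 2.
  by rewrite /phi /D /q; field.
apply: le_trans (ler_normB _ _) _.
have -> : `|b / 2 * (t' - t) ^+ 2| = `|b| / 2 * k ^+ 2.
  by rewrite normrM normrX normrM normfV (@ger0_norm _ 2).
have b0 : 0 <= `|b| := normr_ge0 b.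
have tt2' : k * (`|b| + 1) < e by rewrite -ltr_pdivlMr //; lra.
have h1 : e / (2 * (N + 1)) * (k * N) <= e / 2 * k.
  have -> : e / (2 * (N + 1)) * (k * N) = e / 2 * k * (N / (N + 1)).
    by field; lra.
  rewrite ler_piMr ?mulr_ge0 ?divr_ge0 //; [lra|].
  by rewrite ler_pdivrMr; lra.
nra.
Qed.
End Euclidean.

(** * Neighbourhoods, eventual properties, continuity and Jacobians *)

Section Calculus.
Variable R : realType.
Implicit Types (n m p q : nat).

(** Shaped so that the [delta] clauses of [cont_at], [has_jac] and [has_grad] are instances up to
    conversion, as those of [cvg_seq] are of [evtl]; several local estimates are then intersected
    without handling radii. *)
Definition nearby n (x : 'cV[R]_n) (A : 'cV[R]_n -> Prop) :=
  exists del : R, 0 < del /\ forall y, enorm (y - x) < del -> A y.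
Definition evtl (A : nat -> Prop) := exists N : nat, forall k, (N <= k)%N -> A k.

Lemma nearby_and n (x : 'cV[R]_n) A B :
  nearby x A -> nearby x B -> nearby x (fun y => A y /\ B y).
Proof.
move=> [a [a0 hA]] [b [b0 hB]]; exists (Num.min a b).
rewrite lt_min a0; split=> // y; rewrite lt_min => /andP[ya yb].
by split; [apply: hA | apply: hB].
Qed.

Lemma nearby_sub n (x : 'cV[R]_n) (A B : 'cV[R]_n -> Prop) :
  (forall y, A y -> B y) -> nearby x A -> nearby x B.
Proof. by move=> AB [a [a0 hA]]; exists a; split=> // y /hA /AB. Qed.

Lemma nearby_at n (x : 'cV[R]_n) A : nearby x A -> A x.
Proof. by move=> [a [a0 hA]]; apply: hA; rewrite subrr enorm0. Qed.

Lemma nearby_ball n (x : 'cV[R]_n) r : 0 < r -> nearby x (ball_e x r).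
Proof. by exists r. Qed.

Lemma ball_nearby n (c x : 'cV[R]_n) r : ball_e c r x -> nearby x (ball_e c r).
Proof.
move=> xr; exists (r - enorm (x - c)); split; first by rewrite subr_gt0.
move=> y yx; rewrite /ball_e /=.
by have := ler_enorm_dist y c x; lra.
Qed.

Lemma nearby_nearby n (x : 'cV[R]_n) A : nearby x A -> nearby x (fun y => nearby y A).
Proof.
move=> [a [a0 hA]]; exists a; split=> // y /ball_nearby.
exact: nearby_sub.
Qed.

Lemma nearby_line n (x v : 'cV[R]_n) A : nearby x A ->
  exists t0 : R, 0 < t0 /\ forall t, `|t| < t0 -> A (x + t *: v).
Proof.
move=> [a [a0 hA]]; have v0 := enorm_ge0 v.
exists (a / (enorm v + 1)); split; first by rewrite divr_gt0 //; lra.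
move=> t; rewrite ltr_pdivlMr; last lra.
move=> ta; apply: hA; rewrite addrC addKr enormZ.
have := normr_ge0 t; nra.
Qed.

Lemma nearby_le n (x : 'cV[R]_n) (e : R) :
  0 < e -> nearby x (fun y => enorm (y - x) <= e).
Proof. by exists e; split=> // y /ltW. Qed.

Lemma evtl_and A B : evtl A -> evtl B -> evtl (fun k => A k /\ B k).
Proof.
move=> [a hA] [b hB]; exists (maxn a b) => k; rewrite geq_max => /andP[ka kb].
by split; [apply: hA | apply: hB].
Qed.

Lemma evtl_sub (A B : nat -> Prop) : (forall k, A k -> B k) -> evtl A -> evtl B.
Proof. by move=> AB [a hA]; exists a => k /hA /AB. Qed.

Lemma evtlS A : evtl A -> evtl (fun k => A k.+1).
Proof. by move=> [a hA]; exists a => k ak; apply: hA; apply: leqW. Qed.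

Lemma nearby_cvg n (x : 'cV[R]_n) A u : nearby x A -> cvg_seq u x ->
  evtl (fun k => A (u k)).
Proof.
by move=> [a [a0 hA]] /(_ a a0) [N hN]; exists N => k /hN /hA.
Qed.

Lemma cvg_seq_uniq p q (u : nat -> 'M[R]_(p, q)) a b :
  cvg_seq u a -> cvg_seq u b -> a = b.
Proof.
move=> ua ub; apply/eqP; rewrite -subr_eq0; apply/eqP/enorm_eq0.
apply: ler_of_eps => e e0; rewrite add0r.
have e2 : 0 < e / 2 by lra.
have [N hN] := evtl_and (ua _ e2) (ub _ e2).
have [h1 h2] := hN N (leqnn _).
have := ler_enorm_dist a b (u N); rewrite (enorm_distC a (u N)); lra.
Qed.

Lemma cont_at_cvg n p q (F : 'cV[R]_n -> 'M[R]_(p, q)) x u :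
  cont_at F x -> cvg_seq u x -> cvg_seq (F \o u) (F x).
Proof. by move=> cF ux e e0; apply: nearby_cvg (cF e e0) ux. Qed.

Lemma cont_at_comp n m p q (F : 'cV[R]_n -> 'M[R]_(p, q)) (K : 'cV[R]_m -> 'cV[R]_n) x :
  cont_at K x -> cont_at F (K x) -> cont_at (F \o K) x.
Proof.
move=> cK cF e e0; have [a [a0 ha]] := cF e e0.
by apply: nearby_sub (cK a a0) => y /ha.
Qed.

Lemma cont_at_cst n p q (M : 'M[R]_(p, q)) (x : 'cV[R]_n) : cont_at (fun=> M) x.
Proof. by move=> e e0; exists 1; split=> // y _; rewrite subrr enorm0. Qed.

Lemma cont_atD n p q (F K : 'cV[R]_n -> 'M[R]_(p, q)) x :
  cont_at F x -> cont_at K x -> cont_at (fun y => F y + K y) x.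
Proof.
move=> cF cK e e0; have e2 : 0 < e / 2 by lra.
apply: nearby_sub (nearby_and (cF _ e2) (cK _ e2)) => y [h1 h2].
rewrite opprD addrACA; have := ler_enormD (F y - F x) (K y - K x); lra.
Qed.

Lemma cont_atZ n p q a (F : 'cV[R]_n -> 'M[R]_(p, q)) x :
  cont_at F x -> cont_at (fun y => a *: F y) x.
Proof.
move=> cF e e0; have a0 := normr_ge0 a.
have e1 : 0 < e / (`|a| + 1) by rewrite divr_gt0 //; lra.
apply: nearby_sub (cF _ e1) => y; rewrite -scalerBr enormZ ltr_pdivlMr; last lra.
by have := enorm_ge0 (F y - F x); nra.
Qed.

Lemma cont_atB n p q (F K : 'cV[R]_n -> 'M[R]_(p, q)) x :
  cont_at F x -> cont_at K x -> cont_at (fun y => F y - K y) x.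
Proof.
move=> cF cK; apply: cont_atD => // e e0.
by apply: nearby_sub (cK e e0) => y; rewrite -opprD enormN.
Qed.

Lemma cont_at_mulmx n p q m (F : 'cV[R]_n -> 'M[R]_(p, q)) (K : 'cV[R]_n -> 'M[R]_(q, m)) x :
  cont_at F x -> cont_at K x -> cont_at (fun y => F y *m K y) x.
Proof.
move=> cF cK e e0; have F0 := enorm_ge0 (F x); have K0 := enorm_ge0 (K x).
pose C := enorm (F x) + enorm (K x) + 1.
have C1 : 1 <= C by rewrite /C; lra.
pose e1 := Num.min 1 (e / (2 * C)).
have e10 : 0 < e1 by rewrite lt_min ltr01 divr_gt0 //; lra.
have e11 : e1 <= 1 by rewrite ge_min lexx.
have e1C : e1 * (2 * C) <= e by rewrite -ler_pdivlMr ?ge_min ?lexx ?orbT //; lra.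
apply: nearby_sub (nearby_and (cF _ e10) (cK _ e10)) => y [h1 h2].
have -> : F y *m K y - F x *m K x =
  (F y - F x) *m (K y - K x) + (F y - F x) *m K x + F x *m (K y - K x).
  rewrite !mulmxBr !mulmxBl.
  by apply/matrixP => i j; rewrite ![in RHS]mxE ![in LHS]mxE; ring.
have := ler_enormD ((F y - F x) *m (K y - K x) + (F y - F x) *m K x) (F x *m (K y - K x)).
have := ler_enormD ((F y - F x) *m (K y - K x)) ((F y - F x) *m K x).
have := enorm_mulmx (F y - F x) (K y - K x).
have := enorm_mulmx (F y - F x) (K x).
have := enorm_mulmx (F x) (K y - K x).
have := enorm_ge0 (F y - F x); have := enorm_ge0 (K y - K x).
rewrite /C in e1C C1; nra.
Qed.

Lemma jac_lip n m (F : 'cV[R]_n -> 'cV[R]_m) x J : has_jac F x J ->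
  nearby x (fun y => enorm (F y - F x) <= (enorm J + 1) * enorm (y - x)).
Proof.
move=> /(_ 1 ltr01); apply: nearby_sub => y h.
have := ler_enormD (F y - F x - J *m (y - x)) (J *m (y - x)).
rewrite subrK; have := enorm_mulmx J (y - x); nra.
Qed.

Lemma jac_cont n m (F : 'cV[R]_n -> 'cV[R]_m) x J : has_jac F x J -> cont_at F x.
Proof.
move=> /jac_lip FJ e e0; have J0 := enorm_ge0 J.
have e1 : 0 < e / (enorm J + 2) by rewrite divr_gt0 //; lra.
apply: nearby_sub (nearby_and FJ (ex_intro _ _ (conj e1 (fun y h => h)))) => y.
move=> [h1]; rewrite ltr_pdivlMr; last lra.
by have := enorm_ge0 (y - x); nra.
Qed.

Lemma jac_nearby_eq n m (F K : 'cV[R]_n -> 'cV[R]_m) x J :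
  nearby x (fun y => F y = K y) -> has_jac F x J -> has_jac K x J.
Proof.
move=> FK FJ e e0; have FKx := nearby_at FK.
by apply: nearby_sub (nearby_and FK (FJ e e0)) => y; rewrite FKx => -[->].
Qed.

Lemma jac_uniq n m (F : 'cV[R]_n -> 'cV[R]_m) x J J' :
  has_jac F x J -> has_jac F x J' -> J = J'.
Proof.
move=> FJ FJ'; apply/eqP; rewrite -subr_eq0; apply/eqP/mx_eq0_enorm => u.
apply: enorm_eq0; apply: ler_of_eps => e e0; rewrite add0r.
have u0 := enorm_ge0 u.
have e1 : 0 < e / (2 * (enorm u + 1)) by rewrite divr_gt0 //; lra.
have [t0 [t00 ht]] := nearby_line u (nearby_and (FJ _ e1) (FJ' _ e1)).
have [] := ht (t0 / 2); first by rewrite ger0_norm; lra.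
have -> : x + t0 / 2 *: u - x = t0 / 2 *: u by rewrite addrC addKr.
rewrite -!scalemxAr enormZ ger0_norm; last lra.
set y := x + _ => h1 h2.
have := ler_enormB (F y - F x - t0 / 2 *: (J' *m u)) (F y - F x - t0 / 2 *: (J *m u)).
have -> : F y - F x - t0 / 2 *: (J' *m u) - (F y - F x - t0 / 2 *: (J *m u)) =
   t0 / 2 *: ((J - J') *m u).
  by rewrite mulmxBl scalerBr; apply/matrixP => i j; rewrite !mxE; ring.
rewrite enormZ ger0_norm; last lra.
set N := enorm _ => h3.
have h4 : e / (2 * (enorm u + 1)) * (2 * (enorm u + 1)) = e by field; lra.
have h5 : t0 / 2 * N <= t0 / 2 * e by nra.
by nra.
Qed.

Lemma has_jac_id n (x : 'cV[R]_n) : has_jac id x 1%:M.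
Proof.
move=> e e0; exists 1; split=> // y _; rewrite mul1mx subrr enorm0.
by rewrite mulr_ge0 ?enorm_ge0 // ltW.
Qed.

Lemma has_jacD n m (F K : 'cV[R]_n -> 'cV[R]_m) x J L :
  has_jac F x J -> has_jac K x L -> has_jac (fun y => F y + K y) x (J + L).
Proof.
move=> cF cK e e0; have e2 : 0 < e / 2 by lra.
apply: nearby_sub (nearby_and (cF _ e2) (cK _ e2)) => y [h1 h2].
rewrite mulmxDl; set a := J *m _; set b := L *m _; rewrite -/a in h1; rewrite -/b in h2.
have -> : F y + K y - (F x + K x) - (a + b) = (F y - F x - a) + (K y - K x - b).
  by apply/matrixP => i j; rewrite !mxE; ring.
have := ler_enormD (F y - F x - a) (K y - K x - b); lra.
Qed.

Lemma has_jacZ n m c (F : 'cV[R]_n -> 'cV[R]_m) x J :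
  has_jac F x J -> has_jac (fun y => c *: F y) x (c *: J).
Proof.
move=> cF e e0; have a0 := normr_ge0 c.
have e1 : 0 < e / (`|c| + 1) by rewrite divr_gt0 //; lra.
apply: nearby_sub (cF _ e1) => y; rewrite -scalemxAl -!scalerBr enormZ.
set N := enorm _; set M := enorm _ => h.
have h4 : e / (`|c| + 1) * (`|c| + 1) = e by field; lra.
have M0 : 0 <= M := enorm_ge0 _; have N0 : 0 <= N := enorm_ge0 _.
have h5 : (`|c| + 1) * N <= e * M by rewrite -h4; nra.
nra.
Qed.

Lemma has_jacB n m (F K : 'cV[R]_n -> 'cV[R]_m) x J L :
  has_jac F x J -> has_jac K x L -> has_jac (fun y => F y - K y) x (J - L).
Proof.
move=> FJ /(has_jacZ (-1)) KL; rewrite -scaleN1r.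
by apply: jac_nearby_eq (has_jacD FJ KL); exists 1; split=> // y _; rewrite scaleN1r.
Qed.

Lemma has_jac_comp n m p (F : 'cV[R]_n -> 'cV[R]_m) (K : 'cV[R]_m -> 'cV[R]_p) x J L :
  has_jac F x J -> has_jac K (F x) L -> has_jac (K \o F) x (L *m J).
Proof.
move=> FJ KL e e0; have J0 := enorm_ge0 J; have L0 := enorm_ge0 L.
have e1 : 0 < e / (2 * (enorm J + 1)) by rewrite divr_gt0 //; lra.
have e2 : 0 < e / (2 * (enorm L + 1)) by rewrite divr_gt0 //; lra.
have [a [a0 ha]] := KL _ e1.
apply: nearby_sub (nearby_and (FJ _ e2) (nearby_and (jac_lip FJ) (jac_cont FJ a0))).
move=> y [h1 [h2 /ha h3]] /=; rewrite -mulmxA.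
have := ler_enormD (K (F y) - K (F x) - L *m (F y - F x)) (L *m (F y - F x - J *m (y - x))).
rewrite [X in enorm (_ + X)]mulmxBr subrKA.
have := enorm_mulmx L (F y - F x - J *m (y - x)).
move: h1 h2 h3; set A := enorm (F y - F x - _); set M := enorm (F y - F x).
set E := enorm (_ - L *m (F y - F x)); set D := enorm (y - x); set Z := enorm (L *m _) => h1 h2 h3 h4 h5.
apply: le_trans h5 _.
have M0 : 0 <= M := enorm_ge0 _; have D0 : 0 <= D := enorm_ge0 _.
have A0 : 0 <= A := enorm_ge0 _.
have k1 : e / (2 * (enorm J + 1)) * (2 * (enorm J + 1)) = e by field; lra.
have k2 : e / (2 * (enorm L + 1)) * (2 * (enorm L + 1)) = e by field; lra.
have h3' : 2 * E <= e * D.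
  rewrite -k1; apply: le_trans (_ : 2 * (e / (2 * (enorm J + 1)) * M) <= _); nra.
have h4' : 2 * (enorm L * A) <= e * D.
  rewrite -k2; apply: le_trans (_ : 2 * (enorm L * (e / (2 * (enorm L + 1)) * D)) <= _); nra.
lra.
Qed.
End Calculus.

(** * Taylor bounds, symmetry of the Hessian, Clarke Jacobians of smooth maps *)

Section SecondOrder.
Variable R : realType.
Implicit Types (n m : nat).

Lemma has_gradN n (f : 'cV[R]_n -> R) x v :
  has_grad f x v -> has_grad (fun y => - f y) x (- v).
Proof.
move=> fv e e0; apply: nearby_sub (fv e e0) => y.
by rewrite dotNl -!opprD normrN.
Qed.

Lemma has_gradB n (f k : 'cV[R]_n -> R) x v w :
  has_grad f x v -> has_grad k x w -> has_grad (fun y => f y - k y) x (v - w).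
Proof.
move=> fv kw e e0; have e2 : 0 < e / 2 by lra.
apply: nearby_sub (nearby_and (fv _ e2) (kw _ e2)) => y [h1 h2].
rewrite dotDl dotNl.
have -> : f y - k y - (f x - k x) - (dot v (y - x) - dot w (y - x)) =
  (f y - f x - dot v (y - x)) - (k y - k x - dot w (y - x)) by ring.
apply: le_trans (ler_normB _ _) _; lra.
Qed.

Lemma has_grad_shift n (f : 'cV[R]_n -> R) a x v :
  has_grad f (x + a) v -> has_grad (fun y => f (y + a)) x v.
Proof.
move=> fv e e0; have [d [d0 hd]] := fv e e0; exists d; split=> // y yx.
have E : y - x = y + a - (x + a) by rewrite opprD addrACA subrr addr0.
by rewrite E; apply: hd; rewrite -E.
Qed.

(* Along [- (G' - G)] the touching majorant decreases faster than [F]. *)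
Lemma grad_touch n (F l : 'cV[R]_n -> R) x G G' :
  nearby x (fun y => F y <= l y) -> F x = l x ->
  has_grad F x G -> has_grad l x G' -> G = G'.
Proof.
move=> Fl Flx FG lG; apply/eqP; rewrite eq_sym -subr_eq0; apply/eqP/enorm_eq0.
apply: ler_of_eps => e e0; rewrite add0r.
have e2 : 0 < e / 2 by lra.
set D := G' - G.
have [t0 [t00 ht]] :=
  nearby_line (- D) (nearby_and Fl (nearby_and (FG _ e2) (lG _ e2))).
have [] := ht (t0 / 2); first by rewrite ger0_norm; lra.
set y := x + _; have -> : y - x = t0 / 2 *: - D by rewrite addrC addKr.
rewrite enormZ enormN (@ger0_norm _ (t0 / 2)); last lra.
rewrite !dotZr !dotNr !ler_norml => h1 [/andP[h2 h3] /andP[h4 h5]].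
have : enorm D ^+ 2 = dot G' D - dot G D by rewrite enorm_dot dotDl dotNl.
have D0 := enorm_ge0 D.
rewrite Flx in h2 h3; move: h1 h2 h3 h4 h5.
set N := enorm D in D0 *; set a := dot G' D; set b := dot G D => h1 h2 h3 h4 h5 h6.
have h7 : t0 / 2 * N ^+ 2 <= t0 / 2 * (e * N) by rewrite h6; lra.
have h8 : N ^+ 2 <= e * N by nra.
by nra.
Qed.

Section Descent.
Variables (n : nat) (f : 'cV[R]_n -> R) (gf : 'cV[R]_n -> 'cV[R]_n) (L : R).
Hypothesis fg : forall y, has_grad f y (gf y).
Hypothesis gL : forall y z, enorm (gf y - gf z) <= L * enorm (y - z).

Lemma descent_upper x y :
  f y <= f x + dot (gf x) (y - x) + L / 2 * enorm (y - x) ^+ 2.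
Proof.
set v := y - x; have -> : y = x + v by rewrite addrC subrK.
have : f (x + v) - f x <= dot (gf x) v + L * enorm v ^+ 2 / 2.
  apply: (mean_value_quad (gf := gf)) => t t01; first exact: fg.
  have -> : dot (gf (x + t *: v)) v = dot (gf x) v + dot (gf (x + t *: v) - gf x) v.
    by rewrite !dotE; ring.
  have := dot_le (gf (x + t *: v) - gf x) v.
  have := gL (x + t *: v) x; rewrite [x + _ - x]addrC addKr enormZ (@ger0_norm _ t); last lra.
  have := enorm_ge0 v; nra.
lra.
Qed.
End Descent.

Lemma descent_lower n (f : 'cV[R]_n -> R) gf L x y :
  (forall y, has_grad f y (gf y)) ->
  (forall y z, enorm (gf y - gf z) <= L * enorm (y - z)) ->
  f x + dot (gf x) (y - x) - L / 2 * enorm (y - x) ^+ 2 <= f y.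
Proof.
move=> fg gL.
have := @descent_upper n (fun y => - f y) (fun y => - gf y) L _ _ x y.
rewrite dotNl => h; suff : - f y <= - f x - dot (gf x) (y - x) + L / 2 * enorm (y - x) ^+ 2.
  by lra.
by apply: h => [z|z w]; [exact: has_gradN | rewrite -opprD enormN].
Qed.

(** Differentiability of [gf] at the single point [x] controls the slope on the whole segment: it is
    [dot (gf x) v + t * dot (H *m v) v] up to [e * enorm v ^+ 2]. *)
Lemma taylor2_upper n (f : 'cV[R]_n -> R) gf x H :
  nearby x (fun y => has_grad f y (gf y)) -> has_jac gf x H ->
  forall e, 0 < e -> nearby x (fun y =>
    f y <= f x + dot (gf x) (y - x) + dot (H *m (y - x)) (y - x) / 2
           + e * enorm (y - x) ^+ 2).
Proof.
move=> fg gH e e0; have [d [d0 hd]] := nearby_and fg (gH e e0).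
exists d; split=> // y; set v := y - x => vd.
have -> : y = x + v by rewrite addrC subrK.
have v0 := enorm_ge0 v.
have near t : 0 <= t <= 1 -> enorm (x + t *: v - x) < d.
  move=> t01; rewrite addrC addKr enormZ (@ger0_norm _ t); last lra.
  nra.
have : f (x + v) - f x <=
    dot (gf x) v + e * enorm v ^+ 2 + dot (H *m v) v / 2.
  apply: (mean_value_quad (gf := gf)) => t t01; first by have [] := hd _ (near t t01).
  have [_] := hd _ (near t t01).
  have -> : x + t *: v - x = t *: v by rewrite addrC addKr.
  rewrite -scalemxAr enormZ (@ger0_norm _ t); last lra.
  set w := gf _ - gf x - _ => hw.
  have -> : dot (gf (x + t *: v)) v = dot (gf x) v + dot w v + t * dot (H *m v) v.
    by rewrite /w !dotE; ring.
  have := dot_le w v.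
  have : enorm w * enorm v <= e * enorm v ^+ 2.
    rewrite expr2 mulrA ler_wpM2r //; apply: le_trans hw _.
    by rewrite ler_wpM2l ?(ltW e0) // ler_piMl //; lra.
  lra.
lra.
Qed.

(** The mean value inequality is applied along [t *: u] to the increment [f (y + t *: v) - f y],
    whose gradient is [t *: (H *m v)] plus the difference of two remainders of [gf]. *)
Lemma second_difference_upper n (f : 'cV[R]_n -> R) gf x H u v :
  nearby x (fun y => has_grad f y (gf y)) -> has_jac gf x H ->
  forall e, 0 < e -> exists t0 : R, 0 < t0 /\ forall t, 0 < t < t0 ->
    f (x + t *: u + t *: v) - f (x + t *: u) - f (x + t *: v) + f x
    <= t ^+ 2 * (dot (H *m v) u + e).
Proof.
move=> fg gH e e0.
have u0 := enorm_ge0 u; have v0 := enorm_ge0 v.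
(* The points used stay within [t * C] of [x], so each of the two remainders is at most
   [e' * (t * C)]; pairing them with [u] costs another [C], whence [e' = e / (2 * C ^+ 2)]. *)
pose C := enorm u + enorm v + 1.
have C1 : 1 <= C by rewrite /C; lra.
have C20 : 0 < 2 * C ^+ 2 by nra.
have e1 : 0 < e / (2 * C ^+ 2) by rewrite divr_gt0.
have ee : e / (2 * C ^+ 2) * (2 * C ^+ 2) = e by field; lra.
set e' := e / _ in e1 ee.
have [d [d0 hd]] := nearby_and fg (gH _ e1).
exists (d / C); split; first by rewrite divr_gt0 //; lra.
move=> t /andP[t0]; rewrite ltr_pdivlMr; last lra.
move=> tC.
have near s a : 0 <= s <= 1 -> 0 <= a <= t -> enorm (s *: (t *: u) + a *: v) <= t * C.
  move=> s01 at_; apply: le_trans (ler_enormD _ _) _.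
  rewrite !enormZ (@ger0_norm _ s) ?(@ger0_norm _ t) ?(@ger0_norm _ a); try lra.
  have : s * (t * enorm u) <= t * enorm u by have := mulr_ge0 (ltW t0) u0; nra.
  have : a * enorm v <= t * enorm v by nra.
  rewrite /C; nra.
have key s a : 0 <= s <= 1 -> 0 <= a <= t ->
  has_grad f (x + s *: (t *: u) + a *: v) (gf (x + s *: (t *: u) + a *: v)) /\
  enorm (gf (x + s *: (t *: u) + a *: v) - gf x - H *m (s *: (t *: u) + a *: v))
     <= e' * (t * C).
  move=> s01 at_; have hn := near s a s01 at_.
  have E : x + s *: (t *: u) + a *: v - x = s *: (t *: u) + a *: v.
    by rewrite -[x + _ + _]addrA [LHS]addrC addKr.
  have [|h1 h2] := hd (x + s *: (t *: u) + a *: v); first by rewrite E; lra.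
  by split=> //; rewrite E in h2; apply: le_trans h2 _; rewrite ler_pM2l.
have := @mean_value_quad R n (fun y => f (y + t *: v) - f y)
  (fun y => gf (y + t *: v) - gf y) x (t *: u)
  (t ^+ 2 * (dot (H *m v) u + e)) 0.
rewrite mul0r addr0 => mv.
suff : f (x + t *: u + t *: v) - f (x + t *: u) - (f (x + t *: v) - f x)
    <= t ^+ 2 * (dot (H *m v) u + e) by lra.
have tt : 0 <= t <= t by lra.
have t00 : (0 : R) <= 0 <= t by lra.
apply: mv => s s01.
  have [h1 _] := key s t s01 tt; have [h2 _] := key s 0 s01 t00.
  rewrite scale0r addr0 in h2.
  by apply: has_gradB h2; apply: has_grad_shift.
have [_] := key s t s01 tt; have [_] := key s 0 s01 t00.
rewrite scale0r !addr0 mul0r addr0.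
set w1 := gf _ - _ - _; set w2 := gf (_ + t *: v) - _ - _ => h1 h2.
have -> : gf (x + s *: (t *: u) + t *: v) - gf (x + s *: (t *: u)) =
   t *: (H *m v) + (w2 - w1).
  rewrite /w1 /w2 mulmxDr -!scalemxAr.
  by apply/matrixP => i j; rewrite ![in RHS]mxE ![in LHS]mxE; ring.
rewrite dotZr dotDl dotZl.
have h3 := dot_le (w2 - w1) u; have h4 := ler_enormB w2 w1.
have h5 : dot (w2 - w1) u <= 2 * (e' * (t * C)) * C.
  apply: le_trans h3 _; apply: ler_pM; rewrite ?enorm_ge0 //; last by rewrite /C; lra.
  lra.
rewrite mulrDr mulrA -expr2 mulrDr lerD2l.
have -> : t ^+ 2 * e = t * (2 * (e' * (t * C)) * C) by rewrite -ee; ring.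
by rewrite ler_pM2l.
Qed.

(** The second difference is symmetric in [u] and [v], while its upper bound is not. The bound for
    [f] at [(u, v)] added to the bound for [- f] at [(v, u)] gives one inequality between the two
    bilinear values, and exchanging the vectors gives the other. *)
Lemma hessian_sym n (f : 'cV[R]_n -> R) gf x H :
  nearby x (fun y => has_grad f y (gf y)) -> has_jac gf x H -> H^T = H.
Proof.
move=> fg gH.
have fgN : nearby x (fun y => has_grad (fun z => - f z) y (- gf y)).
  by apply: nearby_sub fg => y; exact: has_gradN.
have gHN : has_jac (fun y => - gf y) x (- H).
  rewrite -scaleN1r; apply: jac_nearby_eq (has_jacZ (-1) gH).
  by exists 1; split=> // y _; rewrite scaleN1r.
have le u v : dot (H *m u) v <= dot (H *m v) u.
  apply: ler_of_eps => e e0; have e2 : 0 < e / 2 by lra.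
  have [a [a0 ha]] := second_difference_upper u v fg gH e2.
  have [b [b0 hb]] := second_difference_upper v u fgN gHN e2.
  pose t := Num.min a b / 2.
  have t0 : 0 < t by rewrite divr_gt0 // lt_min a0.
  have m0 : 0 < Num.min a b by rewrite lt_min a0.
  have ta : t < a by have : Num.min a b <= a by [rewrite ge_min lexx]; rewrite /t; lra.
  have tb : t < b.
    by have : Num.min a b <= b by [rewrite ge_min lexx orbT]; rewrite /t; lra.
  have := ha t; rewrite t0 ta => /(_ isT); have := hb t; rewrite t0 tb => /(_ isT).
  rewrite (addrAC x) mulNmx dotNl.
  set A := f _; set B := f _; set C := f _; set D := dot _ _; set E := dot _ _.
  move=> h1 h2.
  have : 0 <= t ^+ 2 * (E + e / 2 + (- D + e / 2)) by rewrite mulrDr; lra.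
  rewrite pmulr_rge0 ?exprn_gt0 //; lra.
have eq u v : dot (H *m u) v = dot (H *m v) u by apply/eqP; rewrite eq_le !le.
apply/eqP; rewrite -subr_eq0; apply/eqP/mx_eq0_enorm => u.
apply: enorm_eq0; suff -> : enorm ((H^T - H) *m u) = 0 by [].
apply/eqP; rewrite -sqrf_eq0 enorm_dot; set w := _ *m u.
rewrite {1}/w mulmxBl !dotE dot_mulmxl trmxK (dotC u) eq subrr //.
Qed.

(** Jacobians are unique, so those at points near [x] are values of [J]; by continuity every
    limiting Jacobian is [J x], and a convex combination of copies of [J x] collapses. *)
Lemma clarke_C1 n (S : 'cV[R]_n -> set 'cV[R]_n) F J x M :
  nearby x (fun y => S y = [set F y] /\ has_jac F y (J y)) -> cont_at J x ->
  clarke S x M -> M = J x.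
Proof.
move=> nS cJ [m [lam [Ms [_ [lam1 [bM ->]]]]]].
suff E i : Ms i = J x.
  by under eq_bigr => i _ do rewrite E; rewrite -scaler_suml lam1 scale1r.
have [xs [Js [cxs [dS cJs]]]] := bM i.
apply: cvg_seq_uniq cJs _ => e e0.
have cc := cont_at_cvg cJ cxs e0.
apply: evtl_sub (evtl_and cc (nearby_cvg (nearby_nearby nS) cxs)) => k [h1 h2].
suff -> : Js k = J (xs k) by [].
have [r [s [r0 [Ss sJ]]]] := dS k; have [_ FJ] := nearby_at h2.
apply: jac_uniq FJ; apply: jac_nearby_eq sJ.
apply: nearby_sub (nearby_and h2 (nearby_ball _ r0)) => y [[Sy _] /Ss].
by rewrite Sy => /seteqP[/(_ (F y) erefl)].
Qed.
End SecondOrder.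

(** * The proximal model, the forward-backward envelope and the Moreau envelope *)

Section ForwardBackward.
Variables (R : realType) (n : nat) (gam : R).
Hypothesis gam0 : 0 < gam.
Let g2 : 0 < (2 * gam)^-1. Proof. by rewrite invr_gt0 mulr_gt0. Qed.
Implicit Types (f : 'cV[R]_n -> R) (gf : 'cV[R]_n -> 'cV[R]_n) (g : 'cV[R]_n -> \bar R).

Definition fbmodel f gf x u :=
  f x + dot (gf x) (u - x) + (2 * gam)^-1 * enorm (u - x) ^+ 2.

(** Completing the square: up to a term free of [u], the model is the proximal penalty centred at
    the forward step, so minimizing model plus [g] is a proximal step. *)
Lemma fbmodelE f gf x u : fbmodel f gf x u =
  f x - gam / 2 * enorm (gf x) ^+ 2
  + (2 * gam)^-1 * enorm (u - (x - gam *: gf x)) ^+ 2.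
Proof.
have -> : u - (x - gam *: gf x) = (u - x) + gam *: gf x by rewrite opprB addrCA addrC.
rewrite /fbmodel !enorm_dot; move: (u - x) => a; rewrite !dotE (dotC a (gf x)).
by field; rewrite gt_eqF.
Qed.

Lemma prox_fin g w z : proper_fun g -> prox gam g w z -> g z \is a fin_num.
Proof.
move=> [[x gx] gNy] /(_ x) h.
rewrite fin_numE gt_eqF ?gNy //=; apply/negP => /eqP gz; move: h; rewrite gz.
by have := gNy x; move: gx; case: (g x).
Qed.

Lemma prox_le g w z u : proper_fun g -> prox gam g w z -> g u \is a fin_num ->
  fine (g z) + (2 * gam)^-1 * enorm (z - w) ^+ 2 <=
  fine (g u) + (2 * gam)^-1 * enorm (u - w) ^+ 2.
Proof.
move=> pg pz gu; have gz := prox_fin pg pz; have := pz u.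
by rewrite -[in X in (X -> _)%type](fineK gz) -[in X in (X -> _)%type](fineK gu) -!EFinD lee_fin.
Qed.

Lemma fbe_le f gf g x u : g u \is a fin_num ->
  (fbe gam f gf g x <= (fbmodel f gf x u + fine (g u))%:E)%E.
Proof.
move=> gu; rewrite EFinD fineK //; apply: ereal_inf_lbound.
by exists u.
Qed.

Lemma fbe_prox f gf g x z : proper_fun g -> Tgam gam g gf x z ->
  fbe gam f gf g x = (fbmodel f gf x z + fine (g z))%:E.
Proof.
move=> pg Tz; have gz := prox_fin pg Tz.
apply/eqP; rewrite eq_le fbe_le //=.
apply: le_ereal_inf_tmp => _ [u _ <-].
have [gu|] := boolP (g u \is a fin_num).
  have := prox_le pg Tz gu; rewrite -(fineK gu) -EFinD lee_fin -/(fbmodel f gf x u).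
  by rewrite !fbmodelE; lra.
rewrite fin_numE negb_and !negbK => /orP[] /eqP gu.
  by have := pg.2 u; rewrite gu.
by rewrite gu addey // leey.
Qed.

(** With [u] frozen, the gradient of [f] cancels against the derivative of [u - x] inside the inner
    product; [H^T *m (u - x) + gam^-1 *: (x - u)] remains. At a proximal point [u] this is the
    candidate gradient of the envelope. *)
Lemma fbmodel_grad f gf x H u : has_grad f x (gf x) -> has_jac gf x H ->
  has_grad (fun y => fbmodel f gf y u) x (gam^-1 *: ((1%:M - gam *: H)^T *m (x - u))).
Proof.
move=> fg gH e e0; set a := u - x.
have a0 := enorm_ge0 a; have H0 := enorm_ge0 H.
pose K := enorm H + 1 + (2 * gam)^-1.
have K0 : 0 < K by have := g2; rewrite /K; lra.
have e1 : 0 < e / (2 * (1 + enorm a)) by rewrite divr_gt0 //; lra.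
have e2 : 0 < e / (2 * K) by rewrite divr_gt0 //; lra.
have ee1 : e / (2 * (1 + enorm a)) * (2 * (1 + enorm a)) = e by field; lra.
have ee2 : e / (2 * K) * (2 * K) = e by field; lra.
move: e1 e2 ee1 ee2; set e1 := e / _; set e2 := e / _ => e10 e20 ee1 ee2.
apply: nearby_sub (nearby_and (nearby_and (fg _ e10) (gH _ e10))
  (nearby_and (jac_lip gH) (nearby_le x e20))) => y.
set v := y - x; set d := gf y - gf x => -[[h1 h2] [h3 h4]].
have v0 := enorm_ge0 v.
have -> : fbmodel f gf y u - fbmodel f gf x u -
    dot (gam^-1 *: ((1%:M - gam *: H)^T *m (x - u))) v =
  (f y - f x - dot (gf x) v) + dot (d - H *m v) a - dot d v
  + (2 * gam)^-1 * enorm v ^+ 2.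
  rewrite dotZl dotC -dot_mulmxl -(opprB u x) -/a /fbmodel.
  have -> : u - y = a - v by rewrite /a /v opprB addrA subrK.
  rewrite mulmxBl mul1mx -scalemxAl.
  have -> : gf y = gf x + d by rewrite /d addrC subrK.
  rewrite -/a !enorm_dot; move: a v d {h1 h2 h3 h4 a0 v0 K0 e20 e10 ee1 ee2 K e1 e2} => a v d.
  by rewrite !dotE (dotC a v); field; rewrite gt_eqF.
have k1 := dot_norm_le (d - H *m v) a; have k2 := dot_norm_le d v.
have k3 : (2 * gam)^-1 * enorm v ^+ 2 <= (2 * gam)^-1 * enorm v * e2.
  by rewrite expr2 mulrA ler_wpM2l // mulr_ge0 // ltW.
have k4 : `|(2 * gam)^-1 * enorm v ^+ 2| <= (2 * gam)^-1 * enorm v * e2.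
  by rewrite ger0_norm // mulr_ge0 ?sqr_ge0 ?ltW.
have k5 : `|dot d v| <= (enorm H + 1) * enorm v * e2.
  apply: le_trans k2 _; apply: ler_pM; rewrite ?enorm_ge0 //.
have k6 : `|dot (d - H *m v) a| <= e1 * enorm v * enorm a.
  apply: le_trans k1 _; rewrite ler_wpM2r //.
apply: le_trans (ler_normD _ _) _.
apply: le_trans (lerD (ler_normB _ _) k4) _.
apply: le_trans (lerD (lerD (ler_normD _ _) k5) (lexx _)) _.
have -> : e * enorm v = e1 * enorm v + e1 * enorm v * enorm a
   + (enorm H + 1) * enorm v * e2 + (2 * gam)^-1 * enorm v * e2.
  have -> : e1 * enorm v + e1 * enorm v * enorm a
   + (enorm H + 1) * enorm v * e2 + (2 * gam)^-1 * enorm v * e2 =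
   (e1 * (2 * (1 + enorm a)) / 2 + e2 * (2 * K) / 2) * enorm v.
    by rewrite /K; field; rewrite gt_eqF.
  by rewrite ee1 ee2; field.
lra.
Qed.

Section Lipschitz.
Variables (f : 'cV[R]_n -> R) (gf : 'cV[R]_n -> 'cV[R]_n) (L : R).
Hypothesis fg : forall y, has_grad f y (gf y).
Hypothesis gL : forall y z, enorm (gf y - gf z) <= L * enorm (y - z).

(** The descent lemma spends [L / 2] of the proximal weight [(2 * gam)^-1]; the coefficient is what
    is left of it. *)
Lemma fbmodel_lower x u :
  f u + (1 - gam * L) / (2 * gam) * enorm (u - x) ^+ 2 <= fbmodel f gf x u.
Proof.
have := descent_upper fg gL x u; rewrite /fbmodel; set N := _ ^+ 2.
have -> : (1 - gam * L) / (2 * gam) = (2 * gam)^-1 - L / 2 by field; rewrite gt_eqF.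
lra.
Qed.

Lemma fbmodel_upper x u :
  fbmodel f gf x u <= f u + (L / 2 + (2 * gam)^-1) * enorm (u - x) ^+ 2.
Proof. by have := descent_lower x u fg gL; rewrite /fbmodel; lra. Qed.
End Lipschitz.

(** The Moreau envelope read off a selection [s] of the proximal map; where [s w] is a proximal
    point, [g (s w)] is finite and [fine] loses nothing. *)
Definition moreau g (s : 'cV[R]_n -> 'cV[R]_n) w :=
  fine (g (s w)) + (2 * gam)^-1 * enorm (s w - w) ^+ 2.

(** The minimizer [s w] competes in the problem at [w']; expanding the square around [w] gives the
    bound. *)
Lemma moreau_le g s w w' : proper_fun g ->
  prox gam g w (s w) -> prox gam g w' (s w') ->
  moreau g s w' <= moreau g s w + dot (gam^-1 *: (w - s w)) (w' - w)
    + (2 * gam)^-1 * enorm (w' - w) ^+ 2.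
Proof.
move=> pg pw pw'; have := prox_le pg pw' (prox_fin pg pw).
rewrite /moreau; set a := s w - w; set v := w' - w.
have -> : s w - w' = a - v by rewrite /a /v opprB addrA subrK.
have -> : w - s w = - a by rewrite opprB.
rewrite -/(moreau g s w'); move=> h; apply: le_trans h _.
rewrite le_eqVlt; apply/orP; left; apply/eqP.
by rewrite !enorm_dot; move: a v => a v; rewrite !dotE (dotC v a); field; rewrite gt_eqF.
Qed.

(** [moreau_le] bounds the increment from above. With the two points exchanged it bounds it from
    below, with the slope taken at [y], which continuity of [s] brings close to the slope at [w]. *)
Lemma moreau_grad g s w : proper_fun g ->
  nearby w (fun y => prox gam g y (s y)) -> cont_at s w ->
  has_grad (moreau g s) w (gam^-1 *: (w - s w)).
Proof.
move=> pg ns cs e e0; have pw := nearby_at ns.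
have g1 : 0 < gam^-1 by rewrite invr_gt0.
pose e1 := e * gam / 3.
have e10 : 0 < e1 by rewrite divr_gt0 ?mulr_gt0.
apply: nearby_sub (nearby_and ns (nearby_and (cs _ e10) (nearby_le w e10))) => y [py [h1 h2]].
have k1 := moreau_le pg pw py; have k2 := moreau_le pg py pw.
move: k1 k2 h1 h2; rewrite (enorm_distC w y); set v := y - w; set p := s y - s w.
have v0 := enorm_ge0 v.
have -> : gam^-1 *: (y - s y) = gam^-1 *: (w - s w) + gam^-1 *: (v - p).
  by rewrite -scalerDr; congr (_ *: _); apply/matrixP => i j; rewrite !mxE; ring.
have -> : w - y = - v by rewrite opprB.
rewrite dotNr dotDl (dotZl _ (v - p)); set D := dot _ v => k1 k2 h1 h2.
have k3 := dot_le (- (v - p)) v; have k4 := ler_enormB v p.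
rewrite dotNl enormN in k3.
have k5 : - dot (v - p) v <= 2 * e1 * enorm v.
  by apply: le_trans k3 _; rewrite ler_wpM2r //; lra.
have k6 : gam^-1 * - dot (v - p) v <= e * 2 / 3 * enorm v.
  have -> : e * 2 / 3 * enorm v = gam^-1 * (2 * e1 * enorm v).
    by rewrite /e1; field; rewrite gt_eqF.
  by rewrite ler_pM2l.
have k7 : (2 * gam)^-1 * enorm v ^+ 2 <= e / 3 * enorm v.
  have -> : e / 3 * enorm v = (2 * gam)^-1 * (2 * e1 * enorm v).
    by rewrite /e1; field; rewrite gt_eqF.
  rewrite ler_pM2l // expr2 ler_wpM2r //; lra.
have k8 : 0 <= (2 * gam)^-1 * enorm v ^+ 2 by rewrite mulr_ge0 ?sqr_ge0 ?ltW.
have ev : 0 <= e * enorm v by rewrite mulr_ge0 // ltW.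
rewrite ler_norml; apply/andP; split; lra.
Qed.
End ForwardBackward.

(** * Vanishing steps, closedness of the proximal graph, curvature of the envelope *)

Section LocalTheory.
Variable R : realType.

Lemma ler_of_epsC (a b C : R) : 0 <= C ->
  (forall e, 0 < e -> e <= 1 -> a <= b + e * C) -> a <= b.
Proof.
move=> C0 H; apply: ler_of_eps => e e0.
pose e1 := Num.min 1 (e / (C + 1)).
have e10 : 0 < e1 by rewrite lt_min ltr01 divr_gt0 //; lra.
have e11 : e1 <= 1 by rewrite ge_min lexx.
have e1C : e1 * (C + 1) <= e by rewrite -ler_pdivlMr ?ge_min ?lexx ?orbT //; lra.
have := H e1 e10 e11; nra.
Qed.

(** Once [a K] is within [c * e] of the infimum of the nonincreasing [a], no later step can lower it
    by [c * e]. *)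
Lemma summable_steps_cvg0 (a b : nat -> R) (m c : R) : 0 < c ->
  (forall k, m <= a k) -> (forall k, 0 <= b k) ->
  (forall k, a k.+1 <= a k - c * b k) ->
  forall e, 0 < e -> evtl (fun k => b k < e).
Proof.
move=> c0 am b0 ab e e0.
have infa : has_inf (range a).
  by split; [exists (a 0%N); exists 0%N | exists m => _ [k _ <-]].
have ce : 0 < c * e by rewrite mulr_gt0.
have [_ [K _ <-] aK] := inf_adherent ce infa.
have dec k : (K <= k)%N -> a k <= a K.
  elim: k => [|k IH]; first by rewrite leqn0 => /eqP ->.
  rewrite leq_eqVlt => /orP[/eqP -> //|]; rewrite ltnS => /IH.
  by have := ab k; have := mulr_ge0 (ltW c0) (b0 k); lra.
exists K => k /dec ak; rewrite -(ltr_pM2l c0).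
have : inf (range a) <= a k.+1 by apply: ge_inf; [case: infa | exists k.+1].
by have := ab k; lra.
Qed.

Variable n : nat.

(** Since [F] vanishes at [x], the variation of [A] is multiplied by something of order
    [enorm (y - x)], and continuity of [A] makes that product negligible. *)
Lemma has_jac_cont_mul m p (A : 'cV[R]_n -> 'M[R]_(p, m)) (F : 'cV[R]_n -> 'cV[R]_m) x J :
  cont_at A x -> F x = 0 -> has_jac F x J ->
  has_jac (fun y => A y *m F y) x (A x *m J).
Proof.
move=> cA + FJ e e0; have J0 := enorm_ge0 J; have A0 := enorm_ge0 (A x).
have e1 : 0 < e / (2 * (enorm J + 1)) by rewrite divr_gt0 //; lra.
have e2 : 0 < e / (2 * (enorm (A x) + 1)) by rewrite divr_gt0 //; lra.
have k1 : e / (2 * (enorm J + 1)) * (2 * (enorm J + 1)) = e by field; lra.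
have k2 : e / (2 * (enorm (A x) + 1)) * (2 * (enorm (A x) + 1)) = e by field; lra.
move=> F0; apply: nearby_sub (nearby_and (cA _ e1) (nearby_and (FJ _ e2) (jac_lip FJ))) => y.
rewrite {}F0 mulmx0 !subr0 => -[h1 [h2 h3]].
have -> : A y *m F y - A x *m J *m (y - x) =
  (A y - A x) *m F y + A x *m (F y - J *m (y - x)).
  by rewrite mulmxBl [A x *m (F y - _)]mulmxBr subrKA mulmxA.
have h4 := enorm_mulmx (A y - A x) (F y).
have h5 := enorm_mulmx (A x) (F y - J *m (y - x)).
apply: le_trans (ler_enormD _ _) _; apply: le_trans (lerD h4 h5) _.
move: h1 h2 h3 e1 e2 k1 k2 {h4 h5}; set D := enorm (y - x); set dA := enorm (A y - _).
set E := enorm (F y - _); set e1 := e / _; set e2 := e / _ => h1 h2 h3 e10 e20 k1 k2.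
have D0 : 0 <= D := enorm_ge0 _; have dA0 : 0 <= dA := enorm_ge0 _.
have h6 : dA * enorm (F y) <= e1 * ((enorm J + 1) * D).
  by apply: ler_pM; rewrite ?enorm_ge0 // ltW.
have h7 : enorm (A x) * E <= (enorm (A x) + 1) * (e2 * D).
  by apply: ler_pM; rewrite ?enorm_ge0 //; lra.
have -> : e * D = e1 * ((enorm J + 1) * D) + (enorm (A x) + 1) * (e2 * D).
  have -> : e1 * ((enorm J + 1) * D) + (enorm (A x) + 1) * (e2 * D) =
    (e1 * (2 * (enorm J + 1)) + e2 * (2 * (enorm (A x) + 1))) * D / 2 by field.
  by rewrite k1 k2; field.
exact: lerD.
Qed.

Lemma superlinear_le (u : nat -> 'cV[R]_n) l C : 0 <= C -> cvg_seq u l ->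
  (forall e, 0 < e -> evtl (fun k => enorm (u k.+1 - l) <= e * (C * enorm (u k - l)))) ->
  superlinear u l.
Proof.
move=> C0 ul H; split=> // e e0.
have e1 : 0 < e / (C + 1) by rewrite divr_gt0 //; lra.
have k1 : e / (C + 1) * (C + 1) = e by field; lra.
apply: evtl_sub (H _ e1) => k h; apply: le_trans h _.
have := enorm_ge0 (u k - l); set D := enorm _ => D0.
rewrite -[X in _ <= X * _]k1 -[leRHS]mulrA ler_pM2l //; nra.
Qed.

Variable gam : R.
Hypothesis gam0 : 0 < gam.

(** Lower semicontinuity is used through real levels [a] below [g zs]. This also covers
    [g zs = +oo]: a level chosen too high contradicts the limiting inequality [key]. *)
Lemma prox_closed (g : 'cV[R]_n -> \bar R) (w z : nat -> 'cV[R]_n) ws zs :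
  proper_fun g -> lsc g -> cvg_seq w ws -> cvg_seq z zs ->
  (forall k, prox gam g (w k) (z k)) -> prox gam g ws zs.
Proof.
move=> pg lg cw cz pz y.
have g2 : 0 < (2 * gam)^-1 by rewrite invr_gt0 mulr_gt0.
have [gy|] := boolP (g y \is a fin_num); last first.
  rewrite fin_numE negb_and !negbK => /orP[] /eqP gy.
    by have := pg.2 y; rewrite gy.
  by rewrite gy addye // leey.
set Z := enorm (zs - ws); set Y := enorm (y - ws).
have Z0 : 0 <= Z := enorm_ge0 _; have Y0 : 0 <= Y := enorm_ge0 _.
have key a : (a%:E < g zs)%E ->
    a + (2 * gam)^-1 * Z ^+ 2 <= fine (g y) + (2 * gam)^-1 * Y ^+ 2.
  move=> /lg na; apply: (ler_of_epsC (C := (2 * gam)^-1 * (4 * Z + 2 * Y + 1))).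
    by rewrite mulr_ge0 ?ltW //; lra.
  move=> e e0 e1.
  have [N hN] := evtl_and (nearby_cvg na cz) (evtl_and (cw e e0) (cz e e0)).
  have [h1 [h2 h3]] := hN N (leqnn N).
  have h4 := prox_le pg (pz N) gy.
  have gz := prox_fin pg (pz N).
  rewrite -(fineK gz) lte_fin in h1.
  have h5 := ler_enorm_dist y (w N) ws; rewrite -/Y (enorm_distC ws) in h5.
  have h6 := ler_enorm_dist zs ws (z N); rewrite -/Z (enorm_distC zs) in h6.
  have h7 := ler_enorm_dist (z N) ws (w N).
  have X0 := enorm_ge0 (z N - w N); have V0 := enorm_ge0 (y - w N).
  have h8 : enorm (y - w N) ^+ 2 <= Y ^+ 2 + e * (2 * Y + 1) by nra.
  have h9 : Z ^+ 2 - e * (4 * Z) <= enorm (z N - w N) ^+ 2.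
    (* Squaring [Z - 2 * e <= enorm (z N - w N)] requires a nonnegative left side; for smaller [Z]
       the bound [Z ^+ 2 - e * (4 * Z)] is itself nonpositive. *)
    have [hz|hz] := leP (2 * e) Z; last by nra.
    have : Z - 2 * e <= enorm (z N - w N) by lra.
    nra.
  move: h4 (ler_wpM2l (ltW g2) h8) (ler_wpM2l (ltW g2) h9); lra.
rewrite -(fineK gy) -EFinD leNgt; apply/negP => lt.
have [gz|] := boolP (g zs \is a fin_num).
  rewrite -(fineK gz) -EFinD lte_fin in lt.
  pose a := fine (g y) + (2 * gam)^-1 * Y ^+ 2 - (2 * gam)^-1 * Z ^+ 2.
  have := key ((fine (g zs) + a) / 2); rewrite -[X in (_ < X)%E](fineK gz) lte_fin /a.
  by move=> h; have := h _; lra.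
rewrite fin_numE negb_and !negbK => /orP[] /eqP gz.
  by have := pg.2 zs; rewrite gz.
have := key (fine (g y) + (2 * gam)^-1 * Y ^+ 2 - (2 * gam)^-1 * Z ^+ 2 + 1).
by rewrite gz ltry => /(_ isT); lra.
Qed.

(** The envelope where the proximal map is given by [s], in the form that completing the square
    produces, so that [f], the squared gradient and the Moreau term can be expanded separately. *)
Definition fb_value (f : 'cV[R]_n -> R) gf g s x : R :=
  f x - gam / 2 * enorm (gf x) ^+ 2 + moreau gam g s (x - gam *: gf x).

(* The second-order expansion of the envelope along [t *: h] with [t -> 0]:
   the gradient displacement is [t *: a] with [a] close to [H *m h]. *)
Lemma fb_hessian_pos f gf g s x H P kappa :
  proper_fun g ->
  (forall y, has_grad f y (gf y)) -> has_jac gf x H ->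
  s (x - gam *: gf x) = x -> has_jac s (x - gam *: gf x) P ->
  nearby (x - gam *: gf x) (fun w => prox gam g w (s w) /\ cont_at s w) ->
  nearby x (fun y => fb_value f gf g s x + kappa * enorm (y - x) ^+ 2 <= fb_value f gf g s y) ->
  forall h, 2 * kappa * enorm h ^+ 2 <=
    dot ((gam^-1 *: ((1%:M - gam *: H) *m (1%:M - P *m (1%:M - gam *: H)))) *m h) h.
Proof.
move=> pg fg gH sx sP ns lowb h.
have symH : H^T = H.
  by apply: (hessian_sym (f := f) _ gH); exists 1; split.
set w := x - gam *: gf x in sx sP ns.
set M := 1%:M - P; pose k := h - gam *: (H *m h).
(* With [k = Q h] and [Q] symmetric, the form of [B] splits into three parts, each twice the
   second-order coefficient of one summand of [fb_value]. *)
have -> : dot ((gam^-1 *: ((1%:M - gam *: H) *m (1%:M - P *m (1%:M - gam *: H)))) *m h) h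
   = dot (H *m h) h - gam * dot (H *m h) (H *m h) + gam^-1 * dot (M *m k) k.
  have Qh : (1%:M - gam *: H) *m h = k by rewrite mulmxBl mul1mx -scalemxAl.
  have symQ : (1%:M - gam *: H)^T = 1%:M - gam *: H.
    by rewrite linearB /= linearZ /= trmx1 symH.
  rewrite -scalemxAl dotZl -mulmxA [dot ((1%:M - _) *m _) h]dot_mulmxl symQ Qh.
  have -> : (1%:M - P *m (1%:M - gam *: H)) *m h = h - P *m k.
    by rewrite mulmxBl mul1mx -mulmxA Qh.
  have -> : M *m k = k - P *m k by rewrite mulmxBl mul1mx.
  rewrite /k; set p := P *m _; move: p (H *m h) => p a.
  by rewrite !dotE (dotC a h); field; rewrite gt_eqF.
have T2 e : 0 < e -> nearby w (fun y => moreau gam g s y <= moreau gam g s w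
    + dot (gam^-1 *: (w - s w)) (y - w)
    + dot ((gam^-1 *: M) *m (y - w)) (y - w) / 2 + e * enorm (y - w) ^+ 2).
  apply: (taylor2_upper (gf := fun y => gam^-1 *: (y - s y))).
    apply: nearby_sub (nearby_nearby ns) => y ny; have [_ cy] := nearby_at ny.
    by apply: (moreau_grad gam0 pg) => //; apply: nearby_sub ny => z [].
  by apply: has_jacZ; apply: has_jacB => //; apply: has_jac_id.
have nfg : nearby x (fun y => has_grad f y (gf y)) by exists 1; split.
have cw : cont_at (fun y => y - gam *: gf y) x.
  apply: (@jac_cont _ _ _ _ _ (1%:M - gam *: H)).
  by apply: has_jacB; [exact: has_jac_id | exact: has_jacZ].
have h0 := enorm_ge0 h; have k0 := enorm_ge0 k; have M0 := enorm_ge0 M.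
have Hh0 := enorm_ge0 (H *m h).
(* [C1] bounds the cost of replacing the displaced [a] and [b] by [H *m h] and [k]; [C2] bounds the
   two Taylor remainders. *)
pose C1 := gam * enorm (H *m h) * enorm h + enorm M * enorm k * enorm h
   + gam / 2 * enorm M * enorm h * enorm h.
pose C2 := enorm h ^+ 2 + (enorm k + gam * enorm h) ^+ 2.
have C10 : 0 <= C1 by rewrite /C1 !addr_ge0 ?mulr_ge0 // ltW // ltW.
have C20 : 0 <= C2 by rewrite /C2 addr_ge0 ?sqr_ge0.
apply: (ler_of_epsC (C := 2 * (C1 + C2))); first by lra.
move=> e e0 e1; have [d [d0 hd]] := T2 e e0.
have [t0 [t00 ht]] := nearby_line h (nearby_and lowb
  (nearby_and (taylor2_upper nfg gH e0) (nearby_and (gH e e0) (cw d d0)))).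
pose t := t0 / 2; have tp : 0 < t by rewrite /t; lra.
have [] := ht t; first by rewrite ger0_norm /t; lra.
clearbody t; set y := x + _; have -> : y - x = t *: h by rewrite addrC addKr.
move=> l1 [l2 [l3 /hd l4]].
pose rho := t^-1 *: (gf y - gf x) - H *m h.
pose a := H *m h + rho.
have Ea : gf y = gf x + t *: a.
  by rewrite /a /rho [H *m h + _]addrC subrK scalerA divff ?gt_eqF // scale1r [RHS]addrC subrK.
have rho_le : enorm rho <= e * enorm h.
  rewrite -(ler_pM2l tp) mulrCA; move: l3; rewrite enormZ ger0_norm ?(ltW tp) //.
  rewrite -scalemxAr Ea [gf x + _]addrC addrK -scalerBr enormZ ger0_norm ?(ltW tp) //.
  by rewrite /a [H *m h + _]addrC addrK.
have Ew : y - gam *: gf y - w = t *: (h - gam *: a).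
  rewrite /w Ea /y; apply/matrixP => i j; rewrite !mxE; ring.
move: l4; rewrite Ew sx.
have -> : gam^-1 *: (w - x) = - gf x.
  by rewrite /w addrAC subrr add0r scalerN scalerA mulVf ?gt_eqF // scale1r.
have k2 : h - gam *: a = k - gam *: rho by rewrite /a /k scalerDr opprD addrA.
rewrite k2; set b := k - gam *: rho.
have b_le : enorm b <= enorm k + gam * enorm h.
  apply: le_trans (ler_enormB _ _) _; rewrite enormZ ger0_norm ?(ltW gam0) //.
  have : enorm rho <= enorm h by nra.
  by move=> rh; rewrite lerD2l ler_pM2l.
rewrite -scalemxAr -scalemxAl !enormZ !dotZl !dotZr dotNl ger0_norm ?(ltW tp) // => l4.
move: l1; rewrite /fb_value -/w enormZ ger0_norm ?(ltW tp) // => l1.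
move: l2; rewrite -scalemxAr enormZ !dotZl !dotZr ger0_norm ?(ltW tp) // => l2.
have E1 : enorm (gf y) ^+ 2 =
    enorm (gf x) ^+ 2 + 2 * t * dot (gf x) a + t ^+ 2 * dot a a.
  rewrite !enorm_dot Ea; move: (a) (gf x) => a' G.
  by rewrite !dotE (dotC a' G); ring.
rewrite E1 in l1.
have E2 : dot (gf x) b = dot (gf x) h - gam * dot (gf x) a.
  by rewrite /b -k2 dotDr dotNr dotZr.
rewrite E2 in l4.
have E3 : dot a a = dot (H *m h) (H *m h) + 2 * dot (H *m h) rho + dot rho rho.
  by rewrite /a; move: (H *m h) (rho) => p q; rewrite !dotE (dotC q p); ring.
have E4 : dot (M *m b) b = dot (M *m k) k - gam * dot (M *m rho) k
    - gam * dot (M *m k) rho + gam ^+ 2 * dot (M *m rho) rho.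
  rewrite /b mulmxBr -scalemxAr; move: (M *m k) (M *m rho) => p q.
  by move: (k) (rho) => k' r'; rewrite !dotE; ring.
have B1 : - dot (H *m h) rho <= enorm (H *m h) * (e * enorm h).
  rewrite -dotNl; apply: le_trans (dot_le _ _) _; rewrite enormN.
  by rewrite ler_wpM2l.
have B2 : - dot (M *m rho) k <= enorm M * (e * enorm h) * enorm k.
  rewrite -dotNl; apply: le_trans (dot_le _ _) _; rewrite enormN.
  rewrite ler_wpM2r //; apply: le_trans (enorm_mulmx _ _) _.
  by rewrite ler_wpM2l.
have B3 : - dot (M *m k) rho <= enorm M * enorm k * (e * enorm h).
  rewrite -dotNl; apply: le_trans (dot_le _ _) _; rewrite enormN.
  by apply: ler_pM; rewrite ?enorm_ge0 ?enorm_mulmx.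
have B4 : dot (M *m rho) rho <= enorm M * enorm h * (e * enorm h).
  apply: le_trans (dot_le _ _) _; apply: ler_pM; rewrite ?enorm_ge0 //.
  by apply: le_trans (enorm_mulmx _ _) _; rewrite ler_wpM2l //; nra.
have B5 : 0 <= dot rho rho by rewrite -enorm_dot sqr_ge0.
have B6 : enorm b ^+ 2 <= (enorm k + gam * enorm h) ^+ 2.
  by rewrite lerXn2r ?nnegrE ?enorm_ge0 // addr_ge0 // mulr_ge0 // ltW.
(* The first-order terms cancel because [b = h - gam *: a]; dividing by [t ^+ 2] leaves this
   inequality. *)
have S : kappa * enorm h ^+ 2 <= dot (H *m h) h / 2 - gam / 2 * dot a a
   + (2 * gam)^-1 * dot (M *m b) b + e * (enorm h ^+ 2 + enorm b ^+ 2).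
  rewrite -(ler_pM2l (exprn_gt0 2 tp)).
  have Eg : (2 * gam)^-1 = gam^-1 / 2 by field; rewrite gt_eqF.
  rewrite Eg; move: l1 l2 l4; rewrite !exprMn; lra.
have S2 : (2 * gam)^-1 * dot (M *m b) b <= (2 * gam)^-1 * dot (M *m k) k
   + (enorm M * enorm k * enorm h + gam / 2 * enorm M * enorm h * enorm h) * e.
  have g2 : 0 < (2 * gam)^-1 by rewrite invr_gt0 mulr_gt0.
  have -> : (2 * gam)^-1 * dot (M *m k) k
   + (enorm M * enorm k * enorm h + gam / 2 * enorm M * enorm h * enorm h) * e =
   (2 * gam)^-1 * (dot (M *m k) k + gam * (enorm M * (e * enorm h) * enorm k)
     + gam * (enorm M * enorm k * (e * enorm h))
     + gam ^+ 2 * (enorm M * enorm h * (e * enorm h))).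
    by field; rewrite gt_eqF.
  rewrite ler_pM2l // E4.
  have := ler_wpM2l (ltW gam0) B2; have := ler_wpM2l (ltW gam0) B3.
  by have := ler_wpM2l (sqr_ge0 gam) B4; lra.
have S3 : - (gam / 2 * dot a a) <= - (gam / 2 * dot (H *m h) (H *m h))
    + gam * enorm (H *m h) * enorm h * e.
  have := ler_wpM2l (ltW gam0) B1; have := mulr_ge0 (ltW gam0) B5.
  by rewrite E3; lra.
have S4 : e * (enorm h ^+ 2 + enorm b ^+ 2) <= e * C2.
  by rewrite ler_pM2l // lerD2l.
have Eg : gam^-1 * dot (M *m k) k = 2 * ((2 * gam)^-1 * dot (M *m k) k).
  by field; rewrite gt_eqF.
rewrite Eg /C1; lra.
Qed.
End LocalTheory.

(** * Local smoothness data, the Newton contraction and transfer of rates *)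

Section Assembly.
Variables (R : realType) (n : nat).

(** The gradient supplied by [C3_near] is identified with [gf] by letting [f] touch itself in
    [grad_touch]; continuity of [J] comes from differentiability of its vectorization. *)
Lemma C3_jac (f : 'cV[R]_n -> R) gf x : (forall y, has_grad f y (gf y)) ->
  C3_near f x ->
  exists J, nearby x (fun y => has_jac gf y (J y) /\ cont_at J y).
Proof.
move=> fg [r [G [r0 [fG [J [GJ [K [JK _]]]]]]]]; exists J.
exists r; split=> // y yr; have yb : ball_e x r y by [].
split.
  apply: jac_nearby_eq (GJ y yb); apply: nearby_sub (ball_nearby yb) => z zr.
  by apply: (grad_touch (F := f) (l := f)) (fG z zr) (fg z) => //; exists 1.
move=> e e0; apply: nearby_sub (jac_cont (JK y yb) e0) => z.
have -> : (mxvec (J z))^T - (mxvec (J y))^T = (mxvec (J z - J y))^T.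
  by rewrite !linearB.
by rewrite enorm_mxvec.
Qed.

Lemma C1_near_sv_jac (S : 'cV[R]_n -> set 'cV[R]_n) x : C1_near_sv S x ->
  exists s Js, nearby x (fun y => S y = [set s y] /\ has_jac s y (Js y) /\ cont_at Js y).
Proof.
move=> [r [s [r0 [Ss [J [sJ cJ]]]]]]; exists s, J, r; split=> // y yr.
by split; [exact: Ss | split; [exact: sJ | exact: cJ]].
Qed.

Definition posdef (kap : R) (A : 'M[R]_n) :=
  forall h : 'cV[R]_n, kap * enorm h ^+ 2 <= dot (A *m h) h.

Lemma posdef_perturb (A B : 'M[R]_n) kap : posdef kap A ->
  enorm (B - A) <= kap / 2 -> posdef (kap / 2) B.
Proof.
move=> Apos BA h; have := Apos h; have h0 := enorm_ge0 h.
have -> : dot (B *m h) h = dot (A *m h) h + dot ((B - A) *m h) h.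
  by rewrite -dotDl -mulmxDl addrC subrK.
have := dot_norm_le ((B - A) *m h) h; rewrite ler_norml => /andP[h1 _].
have := enorm_mulmx (B - A) h => h2.
have : enorm ((B - A) *m h) * enorm h <= kap / 2 * enorm h ^+ 2.
  rewrite expr2 mulrA ler_wpM2r //; apply: le_trans h2 _; exact: ler_wpM2r.
lra.
Qed.

Lemma posdef_enorm (A : 'M[R]_n) kap : posdef kap A ->
  forall h : 'cV[R]_n, kap * enorm h <= enorm (A *m h).
Proof.
move=> Apos h; have := Apos h; have := dot_le (A *m h) h.
have := enorm_ge0 h; rewrite le_eqVlt => /orP[/eqP <-|h0 h1 h2].
  by move=> _ _; rewrite mulr0 enorm_ge0.
by rewrite -(ler_pM2r h0); apply: le_trans h1; rewrite -mulrA -expr2.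
Qed.

(** [Bf u] applied to the new error is [(Bf u - Bf xs) *m (u - xs)] minus the linearization
    remainder of [G]. Each is at most [e * kap / 4] times the old error, and the modulus [kap / 2]
    of [Bf u] plays the role of a bound on its inverse. *)
Lemma newton_contraction (Bf : 'cV[R]_n -> 'M[R]_n) G xs kap (u d : nat -> 'cV[R]_n) :
  0 < kap -> cont_at Bf xs -> posdef kap (Bf xs) ->
  G xs = 0 -> has_jac G xs (Bf xs) -> cvg_seq u xs ->
  evtl (fun k => Bf (u k) *m d k = - G (u k)) ->
  forall e, 0 < e -> evtl (fun k => enorm (u k + d k - xs) <= e * enorm (u k - xs)).
Proof.
move=> kap0 cB Bpos + GJ cu Bd e e0 => G0.
pose e1 := e * kap / 4.
have e10 : 0 < e1 by rewrite divr_gt0 ?mulr_gt0.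
have kap2 : 0 < kap / 2 by rewrite divr_gt0.
have := nearby_cvg (nearby_and (cB _ kap2) (nearby_and (cB _ e10) (GJ _ e10))) cu.
move=> /(evtl_and Bd); apply: evtl_sub => k [{}Bd [h1 [h2]]].
rewrite {}G0 subr0; set D := enorm (u k - xs) => h3.
have D0 : 0 <= D := enorm_ge0 _.
have h4 := posdef_enorm (posdef_perturb Bpos (ltW h1)) (u k + d k - xs).
move: h4; have -> : Bf (u k) *m (u k + d k - xs) =
    (Bf (u k) - Bf xs) *m (u k - xs) - (G (u k) - Bf xs *m (u k - xs)).
  by rewrite addrAC mulmxDr Bd mulmxBl opprB addrA subrK.
move=> h4; have h5 := ler_enormB ((Bf (u k) - Bf xs) *m (u k - xs)) (G (u k) - Bf xs *m (u k - xs)).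
have h6 : enorm ((Bf (u k) - Bf xs) *m (u k - xs)) <= e1 * D.
  by apply: le_trans (enorm_mulmx _ _) _; rewrite ler_wpM2r // ltW.
rewrite -(ler_pM2l kap2); apply: le_trans h4 _; apply: le_trans h5 _.
have -> : kap / 2 * (e * D) = e1 * D + e1 * D by rewrite /e1; field.
exact: lerD.
Qed.

(* [R_gamma] is nondegenerate at [xs] and [T_gamma] is Lipschitz there, so the
   errors of the three sequences control one another. *)
Lemma superlinear_tail (T : 'cV[R]_n -> 'cV[R]_n) xs JT c gam (x xb r : nat -> 'cV[R]_n) :
  0 < gam -> 0 < c -> T xs = xs -> has_jac T xs JT ->
  nearby xs (fun y => c * enorm (y - xs) <= enorm (y - T y)) ->
  cvg_seq x xs -> cvg_seq xb xs -> cvg_seq r 0 ->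
  evtl (fun k => xb k = T (x k)) -> (forall k, r k = gam^-1 *: (x k - xb k)) ->
  (forall e, 0 < e -> evtl (fun k => enorm (x k.+1 - xs) <= e * enorm (xb k - xs))) ->
  superlinear x xs /\ superlinear xb xs /\ superlinear r 0.
Proof.
move=> gam0 c0 + TJ nT cx cxb cr xbT rE small => Txs.
have g1 : 0 < gam^-1 by rewrite invr_gt0.
pose K := enorm JT + 1; have K0 : 0 < K by have := enorm_ge0 JT; rewrite /K; lra.
have lip : evtl (fun k => enorm (xb k - xs) <= K * enorm (x k - xs)).
  apply: evtl_sub (evtl_and xbT (nearby_cvg (jac_lip TJ) cx)) => k [->].
  by rewrite Txs.
clear Txs.
have lipS := evtlS lip.
have low : evtl (fun k => c * enorm (x k - xs) <= gam * enorm (r k)).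
  apply: evtl_sub (evtl_and xbT (nearby_cvg nT cx)) => k [h1 h2].
  by rewrite rE enormZ (ger0_norm (ltW g1)) mulrA divff ?gt_eqF // mul1r h1.
split; [|split].
- apply: (superlinear_le (ltW K0) cx) => e e0.
  apply: evtl_sub (evtl_and lip (small e e0)) => k [h1 h2].
  by apply: le_trans h2 _; rewrite ler_pM2l.
- apply: (superlinear_le (ltW K0) cxb) => e e0.
  apply: evtl_sub (evtl_and lipS (small e e0)) => k [h1 h2].
  by apply: le_trans h1 _; rewrite mulrCA ler_pM2l.
- have K1 : 0 < 1 + K by lra.
  (* The factors follow the chain from [r k.+1] to [x k.+1], [xb k], [x k] and back to [r k]; the
     contraction contributes [e]. *)
  pose C := gam^-1 * (1 + K) * K * (c^-1 * gam).
  have C0 : 0 < C by rewrite /C !mulr_gt0 ?invr_gt0.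
  apply: (superlinear_le (ltW C0) cr) => e e0.
  apply: evtl_sub (evtl_and low (evtl_and lip (evtl_and lipS (small e e0)))).
  move=> k [h1 [h2 [h3 h4]]]; rewrite !subr0 rE enormZ (ger0_norm (ltW g1)).
  have h5 := ler_enorm_dist (x k.+1) (xb k.+1) xs; rewrite (enorm_distC xs) in h5.
  have h6 : enorm (x k.+1 - xb k.+1) <= (1 + K) * (e * (K * (c^-1 * gam * enorm (r k)))).
    apply: le_trans h5 _; apply: le_trans (_ : (1 + K) * enorm (x k.+1 - xs) <= _).
      lra.
    rewrite ler_pM2l //; apply: le_trans h4 _; rewrite ler_pM2l //.
    apply: le_trans h2 _; rewrite ler_pM2l // -(ler_pM2l c0).
    by rewrite -mulrA mulVKf ?gt_eqF.
  have -> : e * (C * enorm (r k)) =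
    gam^-1 * ((1 + K) * (e * (K * (c^-1 * gam * enorm (r k))))).
    by rewrite /C; ring.
  by rewrite ler_pM2l.
Qed.

Lemma fb_map_jac (s gf : 'cV[R]_n -> 'cV[R]_n) gam x H P :
  has_jac gf x H -> has_jac s (x - gam *: gf x) P ->
  has_jac (fun y => s (y - gam *: gf y)) x (P *m (1%:M - gam *: H)).
Proof.
move=> gJ sJ; apply: (has_jac_comp (F := fun y => y - gam *: gf y)) => //.
by apply: has_jacB; [exact: has_jac_id | exact: has_jacZ].
Qed.

Lemma mulmx_unit_solve (B : 'M[R]_n) (G d : 'cV[R]_n) : B \in unitmx -> d = - (invmx B *m G) ->
  B *m d = - G.
Proof. by move=> Bu ->; rewrite mulmxN mulKVmx. Qed.

(** [eigenvalue] refers to row eigenvectors, so the form is tested at [v^T] after moving [B] across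
    the inner product. *)
Lemma eigen_posdef (B : 'M[R]_n) kap : 0 < kap -> posdef kap B -> ~ lmin_lt0 B.
Proof.
move=> kap0 Bpos [a [/eigenvalueP [v vB v0] a0]].
have := Bpos v^T; have -> : dot (B *m v^T) v^T = a * enorm v^T ^+ 2.
  by rewrite dot_mulmxl -trmx_mul vB linearZ /= dotZr enorm_dot.
have V : 0 < enorm v^T ^+ 2.
  rewrite exprn_gt0 // lt_neqAle enorm_ge0 andbT eq_sym; apply/negP => /eqP ev.
  by move/eqP: v0; apply; apply: enorm_eq0; rewrite -enorm_tr ev.
by nra.
Qed.
End Assembly.

(** * Quadratic growth of the envelope at a strong minimizer *)

Section StrongMinimum.
Variables (R : realType) (n : nat) (gam L c : R).
Variables (f : 'cV[R]_n -> R) (gf : 'cV[R]_n -> 'cV[R]_n) (g : 'cV[R]_n -> \bar R).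
Hypotheses (gam0 : 0 < gam) (fg : forall y, has_grad f y (gf y)).
Hypothesis gL : forall y z, enorm (gf y - gf z) <= L * enorm (y - z).
Hypotheses (c0 : 0 <= c) (gamL : gam * L <= 1).

Lemma fb_valueE s x : fb_value gam f gf g s x =
  fbmodel gam f gf x (s (x - gam *: gf x)) + fine (g (s (x - gam *: gf x))).
Proof. by rewrite fbmodelE // /fb_value /moreau; ring. Qed.

(** For [z = T y] the model margin gives [c' * enorm (z - y) ^+ 2] and strong minimality at [z]
    gives [c * enorm (z - xs) ^+ 2]. The squared distance from [y] to [xs] is at most twice the sum
    of the two squares, hence half of the smaller constant. *)
Lemma fb_strong_min s xs : proper_fun g ->
  nearby xs (fun y => prox gam g (y - gam *: gf y) (s (y - gam *: gf y))) ->
  cont_at (fun y => s (y - gam *: gf y)) xs -> s (xs - gam *: gf xs) = xs ->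
  nearby xs (fun y => g y \is a fin_num ->
    f xs + fine (g xs) + c * enorm (y - xs) ^+ 2 <= f y + fine (g y)) ->
  nearby xs (fun y => fb_value gam f gf g s xs
     + Num.min c ((1 - gam * L) / (2 * gam)) / 2 * enorm (y - xs) ^+ 2
     <= fb_value gam f gf g s y).
Proof.
move=> pg np cT + sm => Txs; set c' := (1 - gam * L) / (2 * gam).
have [d [d0 hd]] := sm.
have Exs : fb_value gam f gf g s xs = f xs + fine (g xs).
  by rewrite fb_valueE Txs /fbmodel !subrr enorm0 dotC dot0l expr0n /=; ring.
have := cT d d0; rewrite Txs => {}cT.
apply: nearby_sub (nearby_and np cT) => y [].
rewrite Exs fb_valueE; set z := s _ => pz /hd hz.
have gz := prox_fin pg pz; have {}hz := hz gz.
have := fbmodel_lower gam0 fg gL y z; rewrite -/c' => h2.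
have h3 := ler_enorm_dist y xs z; rewrite (enorm_distC y z) in h3.
have h4 : Num.min c c' <= c by rewrite ge_min lexx.
have h5 : Num.min c c' <= c' by rewrite ge_min lexx orbT.
have : 0 <= Num.min c c'.
  by rewrite le_min c0 divr_ge0 ?mulr_ge0 ?subr_ge0 // ltW.
clear Txs; move: (Num.min c c') h4 h5 => k h4 h5 k0.
have a0 := enorm_ge0 (z - y); have b0 := enorm_ge0 (z - xs); have y0 := enorm_ge0 (y - xs).
move: hz h2 h3 a0 b0 y0; set A := enorm (z - y); set B := enorm (z - xs); set Y := enorm (y - xs).
move=> hz h2 h3 a0 b0 y0.
have : k * A ^+ 2 <= c' * A ^+ 2 by rewrite ler_wpM2r ?sqr_ge0.
have : k * B ^+ 2 <= c * B ^+ 2 by rewrite ler_wpM2r ?sqr_ge0.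
have : Y ^+ 2 <= (A + B) ^+ 2.
  by rewrite lerXn2r ?nnegrE ?addr_ge0 //; lra.
have := sqr_ge0 (A - B) => AB h6.
have : Y ^+ 2 <= 2 * (A ^+ 2 + B ^+ 2) by lra.
by move=> /(ler_wpM2l k0); lra.
Qed.
End StrongMinimum.

Theorem theorem5p5 (R : realType) (n : nat)
  (f : 'cV[R]_n -> R) (gf : 'cV[R]_n -> 'cV[R]_n) (Lf : R)
  (g : 'cV[R]_n -> \bar R) (gamma_g : \bar R) (rho : R)
  (gam sigma beta mu : R)
  (x xb r rb : nat -> 'cV[R]_n) (Q P B : nat -> 'M[R]_n)
  (d s : nat -> 'cV[R]_n) (tau : nat -> R) (xstar : 'cV[R]_n) :
  (* f differentiable with L_f-Lipschitz gradient gf *)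
  (forall y, has_grad f y (gf y)) ->
  0 <= Lf ->
  (forall y z, enorm (gf y - gf z) <= Lf * enorm (y - z)) ->
  (* g proper, lsc, gamma_g-prox-bounded, rho-weakly convex *)
  proper_fun g -> lsc g -> (0 < gamma_g)%E -> prox_bounded g gamma_g ->
  weakly_convex g rho ->
  (* argmin (f + g) nonempty *)
  (exists y, forall z, ((f y)%:E + g y <= (f z)%:E + g z)%E) ->
  (* parameters: gam in (0, min{1/Lf, gamma_g}) *)
  0 < gam -> gam * Lf < 1 -> (gam%:E < gamma_g)%E ->
  0 < sigma -> sigma < gam * (1 - gam * Lf) / 2 ->
  0 < beta -> beta < 1 -> 0 < mu -> mu < 1 ->
  (* the iterates are generated by PGCL *)
  pgcl_iterates f gf g gam sigma beta mu x xb r rb Q P B d s tau ->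
  (* xb converges to a strong local minimizer xstar of f + g *)
  cvg_seq xb xstar ->
  (exists c eps : R, 0 < c /\ 0 < eps /\
     forall y, enorm (y - xstar) < eps ->
       ((f xstar)%:E + g xstar + (c * enorm (y - xstar) ^+ 2)%:E
        <= (f y)%:E + g y)%E) ->
  (* regularity around xstar *)
  C3_near f xstar ->
  C1_near_sv (prox gam g) (xstar - gam *: gf xstar) ->
  (* eventually d^k is the Newton direction *)
  (exists K : nat, forall k, (K <= k)%N ->
     exists G, has_gradE (fbe gam f gf g) (xb k) G /\
       B k \in unitmx /\ d k = - (invmx (B k) *m G)) ->
  (exists K : nat, forall k, (K <= k)%N -> tau k = 1) /\
  superlinear x xstar /\ superlinear xb xstar /\ superlinear r 0.
Proof.
move=> fg L0 gL pg lg _ _ _ [ym ymin] gam0 gamL _ sig0 sigL b0 b1 mu0 mu1.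
move=> iter cxb [c [eps [c0 [eps0 smin]]]] C3 C1 newt.
have [J nJ] := C3_jac fg C3.
have [ss [Js nss]] := C1_near_sv_jac C1.
pose phi y := f y + fine (g y).
pose c' := (1 - gam * Lf) / (2 * gam).
have c'0 : 0 < c' by rewrite divr_gt0 ?mulr_gt0 //; lra.
have Txb k : Tgam gam g gf (x k) (xb k) by have [] := iter k.
have rE k : r k = gam^-1 *: (x k - xb k) by have [_ []] := iter k.
have gxb k : g (xb k) \is a fin_num := prox_fin pg (Txb k).
have fbx k : fbe gam f gf g (x k) = (fbmodel gam f gf (x k) (xb k) + fine (g (xb k)))%:E.
  exact: fbe_prox.
pose F k := fbmodel gam f gf (x k) (xb k) + fine (g (xb k)).
(* Step norms vanish because the envelope is bounded below. *)
have Flow k : phi (xb k) + c' * (gam ^+ 2 * enorm (r k) ^+ 2) <= F k.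
  have := fbmodel_lower gam0 fg gL (x k) (xb k); rewrite -/c' /F /phi.
  have -> : gam ^+ 2 * enorm (r k) ^+ 2 = enorm (xb k - x k) ^+ 2.
    rewrite rE enormZ ger0_norm ?invr_ge0 ?ltW // exprMn mulrA -exprMn divff ?gt_eqF //.
    by rewrite expr1n mul1r enorm_distC.
  lra.
have sBs k : dot (B k *m s k) (s k) <= 0.
  have [_ [_ [_ [_ [_ [_ [_ [_ [_ [h1 [h2 _]]]]]]]]]]] := iter k.
  by have [/h1/ltW|/h2->] := pselect (lmin_lt0 (B k)).
have Fdec k : F k.+1 <= F k - sigma * enorm (r k) ^+ 2.
  have [_ [_ [_ [_ [_ [_ [_ [_ [_ [_ [_ [[m [tm [acc _]]] xS]]]]]]]]]]]] := iter k.
  have := acc; rewrite -tm -xS !fbx -EFinD lee_fin -/(F k) -/(F k.+1).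
  have : mu / 2 * tau k ^+ 2 * dot (B k *m s k) (s k) <= 0.
    by rewrite mulr_ge0_le0 // mulr_ge0 ?sqr_ge0 // ltW // divr_gt0.
  lra.
have gym : g ym \is a fin_num.
  rewrite fin_numE gt_eqF ?(pg.2 ym) //=; apply/negP => /eqP gy.
  by have := ymin (xb 0%N); rewrite gy -(fineK (gxb 0%N)) -EFinD.
have Fge k : phi ym <= F k.
  apply: le_trans (Flow k); have := ymin (xb k).
  rewrite -(fineK gym) -(fineK (gxb k)) -!EFinD lee_fin -/(phi ym) -/(phi (xb k)) => h.
  have : 0 <= c' * (gam ^+ 2 * enorm (r k) ^+ 2).
    by rewrite (mulr_ge0 (ltW c'0)) // mulr_ge0 ?sqr_ge0.
  lra.
have cr : cvg_seq r 0.
  move=> e e0; have r2 k : 0 <= enorm (r k) ^+ 2 := sqr_ge0 _.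
  apply: evtl_sub (summable_steps_cvg0 sig0 Fge r2 Fdec (exprn_gt0 2 e0)) => k.
  by rewrite subr0 ltr_pXn2r // nnegrE ?enorm_ge0 // ltW.
have cx : cvg_seq x xstar.
  move=> e e0; have e2 : 0 < e / 2 by lra.
  have e3 : 0 < e / 2 / gam by rewrite divr_gt0.
  apply: evtl_sub (evtl_and (cr _ e3) (cxb _ e2)) => k [].
  rewrite subr0 rE enormZ ger0_norm ?invr_ge0 ?ltW // mulrC ltr_pM2r ?invr_gt0 //.
  by have := ler_enorm_dist (x k) xstar (xb k); lra.
have [Jx cJx] := nearby_at nJ.
have [Pws [sws cJsws]] := nearby_at nss.
set ws := xstar - gam *: gf xstar in nss Pws sws cJsws.
have cw : cont_at (fun y => y - gam *: gf y) xstar.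
  by apply: (@jac_cont _ _ _ _ _ (1%:M - gam *: J xstar)); apply: has_jacB;
    [exact: has_jac_id | exact: has_jacZ].
have Txs : ss ws = xstar.
  have : prox gam g ws xstar.
    by apply: (prox_closed gam0 pg lg (cont_at_cvg cw cx) cxb) => k; exact: Txb.
  by rewrite Pws => ->.
pose T y := ss (y - gam *: gf y).
have nT : nearby xstar (fun y => Tgam gam g gf y = [set T y]
    /\ has_jac ss (y - gam *: gf y) (Js (y - gam *: gf y))
    /\ cont_at Js (y - gam *: gf y)).
  have [e [e0 he]] := nss; apply: nearby_sub (cw e e0) => y /he; exact.
have npT : nearby xstar (fun y => prox gam g (y - gam *: gf y) (T y)).
  by apply: nearby_sub nT => y [Ty _]; rewrite -/(Tgam gam g gf y) Ty.
pose Qf y := 1%:M - gam *: J y.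
pose Pf y := Js (y - gam *: gf y).
pose Bf y := gam^-1 *: (Qf y *m (1%:M - Pf y *m Qf y)).
have TJ : has_jac T xstar (Pf xstar *m Qf xstar) := fb_map_jac Jx sws.
have gxs : g xstar \is a fin_num.
  by have := prox_fin pg (nearby_at npT); rewrite /T -/ws Txs.
have sm : nearby xstar (fun y => g y \is a fin_num ->
    phi xstar + c * enorm (y - xstar) ^+ 2 <= phi y).
  exists eps; split=> // y /smin + gy.
  by rewrite -(fineK gxs) -(fineK gy) -!EFinD lee_fin.
(* The growth constant of the envelope; the quadratic form of the second derivative is bounded below
   by twice it. *)
pose kap := Num.min c c' / 2.
have kap0 : 0 < kap by rewrite divr_gt0 // lt_min c0.
have fbmin := fb_strong_min gam0 fg gL (ltW c0) (ltW gamL) pg npT (jac_cont TJ) Txs sm.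
have Bpos : posdef (2 * kap) (Bf xstar).
  apply: (fb_hessian_pos gam0 pg fg Jx Txs sws) fbmin.
  apply: nearby_sub nss => w [Pw [sw _]]; split; first by rewrite Pw.
  exact: jac_cont sw.
have kap20 : 0 < 2 * kap by rewrite mulr_gt0.
have cQ y : cont_at J y -> cont_at Qf y.
  by move=> cJ; apply: cont_atB; [exact: cont_at_cst | exact: cont_atZ].
have cP : cont_at Pf xstar by apply: cont_at_comp cw cJsws.
have cB : cont_at Bf xstar.
  apply: cont_atZ; apply: cont_at_mulmx (cQ _ cJx) _.
  apply: cont_atB; first exact: cont_at_cst.
  by apply: cont_at_mulmx cP (cQ _ cJx).
have symQ : (Qf xstar)^T = Qf xstar.
  have : (J xstar)^T = J xstar.
    by apply: (hessian_sym (f := f) _ Jx); exists 1; split.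
  by rewrite /Qf linearB /= linearZ /= trmx1 => ->.
(* The transpose stays because symmetry is recorded at [xstar] only, where it turns the Jacobian of
   [G] into [Bf xstar]. *)
pose G y := (Qf y)^T *m (gam^-1 *: (y - T y)).
have RJ : has_jac (fun y => gam^-1 *: (y - T y)) xstar
    (gam^-1 *: (1%:M - Pf xstar *m Qf xstar)).
  by apply: has_jacZ; apply: has_jacB TJ; exact: has_jac_id.
have R0 : gam^-1 *: (xstar - T xstar) = 0 by rewrite /T Txs subrr scaler0.
have G0 : G xstar = 0 by rewrite /G R0 mulmx0.
have GJ : has_jac G xstar (Bf xstar).
  have cQT : cont_at (fun y => (Qf y)^T) xstar.
    move=> e e0; apply: nearby_sub (cQ _ cJx e e0) => y.
    by rewrite -linearB /= enorm_tr.
  have := has_jac_cont_mul cQT R0 RJ; rewrite symQ -scalemxAr.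
  by apply.
(* Collapsing the Clarke set at [xb k] takes smoothness on a whole neighbourhood of [xb k], which
   [nearby_nearby] supplies. *)
have Qk : evtl (fun k => Q k = Qf (xb k)).
  apply: evtl_sub (nearby_cvg (nearby_nearby nJ) cxb) => k nJk.
  have [_ [_ [_ [[H [cH ->]] _]]]] := iter k.
  have [_ cJk] := nearby_at nJk.
  rewrite (clarke_C1 (F := gf) _ cJk cH) //.
  by apply: nearby_sub nJk => y [].
have Pk : evtl (fun k => P k = Pf (xb k)).
  have [e [e0 he]] := nearby_nearby nss.
  apply: evtl_sub (nearby_cvg (cw e e0) cxb) => k /he nk.
  have [_ [_ [_ [_ [cPk _]]]]] := iter k.
  have [_ [_ cJk]] := nearby_at nk.
  rewrite (clarke_C1 (F := ss) _ cJk cPk) //.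
  by apply: nearby_sub nk => y [h1 [h2 _]].
have Bk : evtl (fun k => B k = Bf (xb k)).
  apply: evtl_sub (evtl_and Qk Pk) => k [Qk' Pk'].
  by have [_ [_ [_ [_ [_ [-> _]]]]]] := iter k; rewrite Qk' Pk'.
have sk : evtl (fun k => s k = 0).
  apply: evtl_sub (evtl_and Bk (nearby_cvg (cB _ kap0) cxb)) => k [Bk' near].
  have [_ [_ [_ [_ [_ [_ [_ [_ [_ [_ [h2 _]]]]]]]]]]] := iter k.
  have pos : posdef kap (B k).
    have := @posdef_perturb _ _ (Bf xstar) (B k) _ Bpos.
    have -> : 2 * kap / 2 = kap by field.
    by apply; rewrite Bk' ltW.
  have := pos (s k); rewrite (h2 (eigen_posdef kap0 pos)) => h.
  apply: enorm_eq0; rewrite -(@ler_pXn2r _ 2) ?nnegrE ?enorm_ge0 //.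
  by rewrite expr0n -(ler_pM2l kap0) mulr0.
have dk : evtl (fun k => Bf (xb k) *m d k = - G (xb k)).
  apply: evtl_sub (evtl_and (evtl_and Bk newt) (evtl_and (nearby_cvg nJ cxb)
    (nearby_cvg nT cxb))) => k [[Bk' [Gk [[nfin hG] [Bu dE]]]] [[Jk _] [Tk _]]].
  rewrite -Bk' (mulmx_unit_solve Bu dE); congr (- _).
  have Tk' : Tgam gam g gf (xb k) (T (xb k)) by rewrite Tk.
  have gT := prox_fin pg Tk'.
  have -> : G (xb k) = gam^-1 *: ((Qf (xb k))^T *m (xb k - T (xb k))).
    by rewrite /G -scalemxAr.
  (* The envelope lies below the model with [u = T (xb k)] fixed and touches it
     at [xb k], so differentiability makes the gradients agree. *)
  apply: (grad_touch (l := fun y => fbmodel gam f gf y (T (xb k)) + fine (g (T (xb k))))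
    _ _ hG).
  - apply: nearby_sub nfin => y fy; rewrite -lee_fin fineK //; exact: fbe_le.
  - by rewrite (fbe_prox gam0 f pg Tk').
  - move=> e e0; apply: nearby_sub (fbmodel_grad gam0 (T (xb k)) (fg _) Jk e0) => y.
    by rewrite [fbmodel _ _ _ (xb k) _ + _]addrC addrKA.
have contr := newton_contraction kap20 cB Bpos G0 GJ cxb dk.
pose C := Lf / 2 + (2 * gam)^-1.
have C0 : 0 < C.
  have : 0 < (2 * gam)^-1 by rewrite invr_gt0 mulr_gt0.
  by rewrite /C; lra.
have tau1 : evtl (fun k => tau k = 1).
  (* Chosen so that [C * e ^+ 2 <= c]: the quadratic excess at the Newton point then fits under the
     growth at [xb k]. *)
  pose e := Num.min 1 (c / C).
  have e0 : 0 < e by rewrite lt_min ltr01 divr_gt0.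
  have e1 : e <= 1 by rewrite ge_min lexx.
  have eC : e * C <= c by rewrite -ler_pdivlMr // ge_min lexx orbT.
  apply: evtl_sub (evtl_and (evtl_and sk (contr e e0)) (nearby_cvg sm cxb)) => k.
  move=> [[sk0 hN] hsm].
  have [_ [_ [_ [_ [_ [_ [_ [_ [_ [_ [_ [[m [tm [_ rej]]] _]]]]]]]]]]]] := iter k.
  (* A positive exponent would mean that [beta ^+ 0 = 1] was rejected, so it is enough to show that
     the unit step passes. *)
  case: m tm rej => [-> _|m _ /(_ 0%N isT) []]; first by rewrite expr0.
  rewrite expr0 expr1n !scale1r sk0 addr0 mulmx0 dot0l mulr0 addr0 fbx -EFinD.
  (* Inserting [xstar] into the infimum bounds the envelope at the trial point without reference to
     its proximal point. *)
  apply: le_trans (fbe_le gam f gf (xb k + d k) gxs) _.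
  rewrite lee_fin -/(F k).
  have h1 := fbmodel_upper gam fg gL (xb k + d k) xstar.
  rewrite -/C enorm_distC in h1.
  have h2 := hsm (gxb k); have h3 := Flow k.
  have h4 : C * enorm (xb k + d k - xstar) ^+ 2 <= c * enorm (xb k - xstar) ^+ 2.
    apply: le_trans (_ : C * (e * enorm (xb k - xstar)) ^+ 2 <= _).
      rewrite ler_pM2l // lerXn2r ?nnegrE ?enorm_ge0 // mulr_ge0 ?enorm_ge0 //.
      exact: ltW.
    have D2 : 0 <= enorm (xb k - xstar) ^+ 2 := sqr_ge0 _.
    have -> : C * (e * enorm (xb k - xstar)) ^+ 2 =
      e * (e * C) * enorm (xb k - xstar) ^+ 2 by ring.
    by apply: ler_wpM2r D2 _ _ _; nra.
  have h5 : sigma * enorm (r k) ^+ 2 <= c' * (gam ^+ 2 * enorm (r k) ^+ 2).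
    have -> : c' * (gam ^+ 2 * enorm (r k) ^+ 2) =
      gam * (1 - gam * Lf) / 2 * enorm (r k) ^+ 2.
      by rewrite /c'; field; rewrite gt_eqF.
    by rewrite ler_wpM2r ?sqr_ge0 // ltW.
  by move: h2; rewrite /phi in h3 *; lra.
split; first exact: tau1.
have xbT : evtl (fun k => xb k = T (x k)).
  apply: evtl_sub (nearby_cvg nT cx) => k [Tk _].
  by have := Txb k; rewrite Tk.
have small e : 0 < e -> evtl (fun k => enorm (x k.+1 - xstar) <= e * enorm (xb k - xstar)).
  move=> e0; apply: evtl_sub (evtl_and tau1 (evtl_and sk (contr e e0))) => k [t1 [s0 h]].
  have [_ [_ [_ [_ [_ [_ [_ [_ [_ [_ [_ [_ ->]]]]]]]]]]]] := iter k.
  by rewrite t1 s0 expr1n !scale1r addr0.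
(* Nondegeneracy of the residual: [Bf xstar] is [Qf xstar] times the Jacobian [A] of the residual,
   so [q * enorm (A *m h)] is at least [2 * kap * enorm h]. The linearization error, held to
   [kap / q], consumes half of this. *)
pose q := enorm (Qf xstar) + 1.
have q0 : 0 < q by have := enorm_ge0 (Qf xstar); rewrite /q; lra.
have e10 : 0 < kap / q by rewrite divr_gt0.
have cl0 : 0 < gam * (kap / q) by rewrite mulr_gt0.
apply: (superlinear_tail gam0 cl0 Txs TJ _ cx cxb cr xbT rE small).
apply: nearby_sub (RJ _ e10) => y; rewrite R0 subr0.
set h := y - xstar; set A := gam^-1 *: (1%:M - _) => h1.
have h2 := posdef_enorm Bpos h.
have BA : Bf xstar = Qf xstar *m A by rewrite /A -scalemxAr.
rewrite BA -mulmxA in h2.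
have h3 := enorm_mulmx (Qf xstar) (A *m h).
have h4 := ler_enorm_dist (A *m h) 0 (gam^-1 *: (y - T y)).
have g1 : 0 < gam^-1 by rewrite invr_gt0.
rewrite !subr0 enorm_distC enormZ (ger0_norm (ltW g1)) in h4.
have h5 : 2 * kap * enorm h <= q * (gam^-1 * enorm (y - T y)) + kap * enorm h.
  have -> : kap * enorm h = q * (kap / q * enorm h) by field; rewrite gt_eqF.
  have : enorm (Qf xstar) * enorm (A *m h) <= q * enorm (A *m h).
    by rewrite ler_wpM2r ?enorm_ge0 // /q; lra.
  have : q * enorm (A *m h) <= q * (kap / q * enorm h + gam^-1 * enorm (y - T y)).
    by rewrite ler_pM2l //; lra.
  lra.
have -> : gam * (kap / q) * enorm h = gam / q * (kap * enorm h) by field; rewrite gt_eqF.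
have -> : enorm (y - T y) = gam / q * (q * (gam^-1 * enorm (y - T y))).
  by field; rewrite !gt_eqF.
rewrite ler_pM2l ?divr_gt0 //; lra.
Qed.
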